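(* Let $A,B$ be quantum systems with Hilbert spaces of finite dimensions $d_A,d_B$, and put $d=\min(d_A,d_B)$. Let $|\psi\rangle_{AB}=\sum_{i=1}^{d} C_i|i\rangle_A|i\rangle_B$ be a unit vector written in a Schmidt basis (with $C_i\ge 0$, and the Schmidt vectors completed to orthonormal bases of $A$ and $B$), and let $H=\sum_{k,l=1}^{d_A}\sum_{m,n=1}^{d_B}H_{kl,mn}\,|k\rangle\langle l|_A\otimes|m\rangle\langle n|_B$ be a Hermitian operator expanded in this basis. Write $H_{ji}:=H_{ji,ji}$ and let $H_{I,ji}$ be the imaginary part of $H_{ji}$. Then the entanglement generation rate satisfies $$\Gamma(\psi,H)=4\sum_{\substack{i,j=1\\ i>j}}^{d}C_iC_j\,\log\!\left(\frac{C_i}{C_j}\right)H_{I,ji}.$$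
   Context: For a pure bipartite state $|\psi\rangle$ and a Hermitian operator $H$ on $A\otimes B$, $\Gamma(\psi,H):=\frac{d}{dt}E\big(e^{-iHt}|\psi\rangle\langle\psi|e^{iHt}\big)\big|_{t=0}$, where $E$ is the relative entropy of entanglement. On pure states $E$ equals the entanglement entropy $S(\rho_A)=-\mathrm{Tr}(\rho_A\log\rho_A)$, $\rho_A=\mathrm{Tr}_B|\psi\rangle\langle\psi|$. The logarithm is taken to a fixed base. Terms with $C_iC_j=0$ are read as $0$. *)

(* Defs.v *)
From HB Require Import structures.
From mathcomp Require Import all_boot all_order all_algebra.
From mathcomp Require Import all_classical all_reals all_analysis.
From mathcomp Require Import complex mxtens.
Set Implicit Arguments.
Unset Strict Implicit.
Unset Printing Implicit Defensive.
Import Order.TTheory GRing.Theory Num.Theory.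
Import numFieldNormedType.Exports.
Local Open Scope classical_set_scope.
Local Open Scope ring_scope.
Local Open Scope complex_scope.
Local Open Scope sesquilinear_scope.

Section Defs.
Context {R : realType}.
Local Notation C := R[i].

Definition logb (b x : R) : R := ln x / ln b.

(* Functional calculus of a Hermitian matrix A = P^* diag(d) P, P unitary:
   f(A) = P^* diag(f d) P.  By herm_funE below, the value does not depend on
   the diagonalization chosen by the library. *)
Definition herm_fun n (f : R -> C) (A : 'M[C]_n) : 'M[C]_n :=
  (spectralmx A)^t* *m diag_mx (\row_k f (complex.Re (spectral_diag A 0 k)))
    *m spectralmx A.

Lemma herm_funE n (f : R -> C) (P : 'M[C]_n) (d : 'I_n -> R) :
  P \is unitarymx ->
  herm_fun f (P^t* *m diag_mx (\row_k (d k)%:C) *m P) =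
    P^t* *m diag_mx (\row_k f (d k)) *m P.
Proof.
move=> Pu; set A := (X in herm_fun f X).
have An : A \is normalmx.
  apply/orthomx_spectral_subproof; exists (P, \row_k (d k)%:C) => //=.
  by rewrite invmx_unitary.
have PtP : P^t* *m P = 1%:M.
  by rewrite -invmx_unitary// mulVmx// unitarymx_unit.
have PPt : P *m P^t* = 1%:M by exact/unitarymxP.
rewrite /herm_fun; set Q := spectralmx A; set e := spectral_diag A.
have Qu : Q \is unitarymx := spectral_unitarymx A.
have QtQ : Q^t* *m Q = 1%:M.
  by rewrite -invmx_unitary// mulVmx// unitarymx_unit.
have QQt : Q *m Q^t* = 1%:M by exact/unitarymxP.
have AE : A = Q^t* *m diag_mx e *m Q.
  by rewrite {1}(orthomx_spectralP An) invmx_unitary.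
set W := Q *m P^t*.
have WE : diag_mx e *m W = W *m diag_mx (\row_k (d k)%:C).
  have -> : diag_mx e *m W = Q *m A *m P^t*.
    by rewrite AE !mulmxA QQt mul1mx -mulmxA.
  by rewrite /A !mulmxA -[_ *m P *m _]mulmxA PPt mulmx1.
have fWE : diag_mx (\row_k f (complex.Re (e 0 k))) *m W =
    W *m diag_mx (\row_k f (d k)).
  move: WE; clearbody W => WE; apply/matrixP => i j; move/matrixP: WE => /(_ i j).
  rewrite !mul_diag_mx !mul_mx_diag !mxE.
  have [->|W0] := eqVneq (W i j) 0; first by rewrite !(mul0r, mulr0).
  rewrite [X in _ = X]mulrC => /(mulIf W0) ->.
  by rewrite [RHS]mulrC.
have QE : Q = W *m P by rewrite /W -mulmxA PtP mulmx1.
rewrite [X in _ *m X = _]QE mulmxA -[X in X *m P]mulmxA fWE.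
by rewrite /W !mulmxA QtQ mul1mx.
Qed.

(* e^{itA} *)
Definition expi n (A : 'M[C]_n) (t : R) : 'M[C]_n :=
  herm_fun (fun x => cos (t * x) +i* sin (t * x)) A.

(* Since ln 0 = 0, this is the logarithm on the support, with 0 log 0 = 0. *)
Definition logmx (b : R) n (A : 'M[C]_n) : 'M[C]_n :=
  herm_fun (fun x => (logb b x)%:C) A.

Definition density n (rho : 'M[C]_n) : Prop :=
  [/\ rho \is hermsymmx,
      forall v : 'cV[C]_n, 0 <= (v^t* *m rho *m v) 0 0
    & \tr rho = 1].

Definition separable dA dB (sigma : 'M[C]_(dA * dB)) : Prop :=
  exists (n : nat) (p : 'I_n -> R)
         (rho : 'I_n -> 'M[C]_dA) (tau : 'I_n -> 'M[C]_dB),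
    [/\ forall k, 0 <= p k,
        \sum_k p k = 1,
        forall k, density (rho k) /\ density (tau k)
      & sigma = \sum_k (p k)%:C *: (rho k *t tau k)].

(* S(rho || sigma); the row-space inclusion is, for Hermitian matrices,
   supp rho `<=` supp sigma. *)
Definition relative_entropy (b : R) n (rho sigma : 'M[C]_n) : \bar R :=
  if (rho <= sigma)%MS
  then (complex.Re (\tr (rho *m (logmx b rho - logmx b sigma))))%:E
  else +oo%E.

Definition relative_entropy_of_entanglement (b : R) dA dB
    (rho : 'M[C]_(dA * dB)) : \bar R :=
  ereal_inf [set relative_entropy b rho sigma | sigma in @separable dA dB].

(* t |-> E(e^{-iHt} |psi><psi| e^{iHt}); E is finite, so fine loses nothing *)
Definition entanglement_curve (b : R) dA dB
    (psi : 'cV[C]_(dA * dB)) (H : 'M[C]_(dA * dB)) (t : R) : R :=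
  fine (relative_entropy_of_entanglement b
          (expi H (- t) *m (psi *m psi^t*) *m expi H t)).

Definition entanglement_rate (b : R) dA dB
    (psi : 'cV[C]_(dA * dB)) (H : 'M[C]_(dA * dB)) : R :=
  derive1 (entanglement_curve b psi H) 0.

Definition orthonormal_basis n (e : 'I_n -> 'cV[C]_n) : Prop :=
  forall k l, (e k)^t* *m e l = (k == l)%:R%:M.

End Defs.

(* Main.v *)
(** For a pure state v, the relative entropy to sigma is -<v, ln(sigma) v>.
    Upper bound on E(v(t)): take for sigma a separable state diagonal in the
    Schmidt basis of v(0).  Lower bound: if sigma is separable then
    sigma <= omega (x) 1 (reduction criterion), so operator monotonicity of the
    square root, iterated, bounds <v, ln(sigma) v> by Tr(rho ln omega), where
    rho is the reduced state of v; Klein's inequality and a chi-square bound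
    then replace omega by any matrix diagonal in the fixed Schmidt basis.
    With both comparison matrices regularized by a small multiple of a power
    of |t|, the two bounds agree with the cross entropy
    -sum_j w_j(t) ln w_j(0), w_j(t) being the squared amplitudes of v(t) in the
    product Schmidt basis at time 0, up to O(|t|^(3/2)).  Hence E has the
    derivative of this cross entropy at 0, even when the Schmidt coefficients
    vanish or coincide, and no diagonalization at time t has to be followed. *)

Require Import Defs.
From mathcomp Require Import all_boot all_order all_algebra.
From mathcomp Require Import all_classical all_reals all_analysis.
From mathcomp Require Import complex mxtens.
From mathcomp Require Import ring lra.
Set Implicit Arguments.
Unset Strict Implicit.
Unset Printing Implicit Defensive.
Import Order.TTheory GRing.Theory Num.Theory.
Import numFieldNormedType.Exports.
Local Open Scope ring_scope.
Local Open Scope complex_scope.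
Local Open Scope sesquilinear_scope.

(** * Hermitian matrices and the Loewner order *)

Section Adjoint.
Context {R : realType}.
Local Notation C := R[i].

Definition sqn (z : C) : R := complex.Re z ^+ 2 + complex.Im z ^+ 2.

Lemma sqn_ge0 z : 0 <= sqn z.
Proof. by rewrite addr_ge0 ?sqr_ge0. Qed.

Lemma mul_conj_sqn (z : C) : z^*%C * z = (sqn z)%:C.
Proof.
case: z => x y; rewrite /sqn; simpc => /=.
by apply/eqP; rewrite eq_complex /=; apply/andP; split; apply/eqP; ring.
Qed.

Lemma conjCE (z : C) : Num.conj z = z^*%C. Proof. by []. Qed.

Lemma Re_sum I (r : seq I) (P : pred I) (F : I -> C) :
  complex.Re (\sum_(i <- r | P i) F i) = \sum_(i <- r | P i) complex.Re (F i).
Proof. by apply: (big_morph (@complex.Re R)) => // -[? ?] [? ?]. Qed.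

Lemma Im_sum I (r : seq I) (P : pred I) (F : I -> C) :
  complex.Im (\sum_(i <- r | P i) F i) = \sum_(i <- r | P i) complex.Im (F i).
Proof. by apply: (big_morph (@complex.Im R)) => // -[? ?] [? ?]. Qed.

Lemma ReM_real (x : R) (z : C) : complex.Re (x%:C * z) = x * complex.Re z.
Proof. by case: z => ? ?; simpc. Qed.

Lemma ImM_real (x : R) (z : C) : complex.Im (x%:C * z) = x * complex.Im z.
Proof. by case: z => ? ?; simpc. Qed.

Lemma adjM m n p (A : 'M[C]_(m, n)) (B : 'M[C]_(n, p)) :
  (A *m B)^t* = B^t* *m A^t*.
Proof. by rewrite trmx_mul map_mxM. Qed.

Lemma adjD m n (A B : 'M[C]_(m, n)) : (A + B)^t* = A^t* + B^t*.
Proof. by rewrite linearD map_mxD. Qed.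

Lemma adjB m n (A B : 'M[C]_(m, n)) : (A - B)^t* = A^t* - B^t*.
Proof. by rewrite linearB map_mxB. Qed.

Lemma adj_sum m n I (r : seq I) (P : pred I) (F : I -> 'M[C]_(m, n)) :
  (\sum_(i <- r | P i) F i)^t* = \sum_(i <- r | P i) (F i)^t*.
Proof.
apply: (big_morph (fun A : 'M[C]_(m, n) => A^t*)); last first.
  by rewrite linear0 map_mx0.
by move=> A B; rewrite adjD.
Qed.

Lemma adjZ_real m n (x : R) (A : 'M[C]_(m, n)) : (x%:C *: A)^t* = x%:C *: A^t*.
Proof. by rewrite linearZ map_mxZ /= conjCE conjc_real. Qed.

Lemma adj1 n : (1%:M : 'M[C]_n)^t* = 1%:M.
Proof. by rewrite trmx1 map_mx1. Qed.

Lemma adj_tens m n p q (A : 'M[C]_(m, n)) (B : 'M[C]_(p, q)) :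
  (A *t B)^t* = A^t* *t B^t*.
Proof. by rewrite trmx_tens map_mxT. Qed.

Lemma adjK m n (A : 'M[C]_(m, n)) : A^t*^t* = A.
Proof. exact: trmxCK. Qed.

Lemma adjE m n (A : 'M[C]_(m, n)) i j : A^t* i j = (A j i)^*%C.
Proof. by rewrite !mxE. Qed.

Lemma hermsym_adj n (A : 'M[C]_n) : A \is hermsymmx -> A^t* = A.
Proof. by move=> /is_hermitianmxP {2}->; rewrite expr0 scale1r. Qed.

Lemma adj_hermsym n (A : 'M[C]_n) : A^t* = A -> A \is hermsymmx.
Proof. by move=> AE; apply/is_hermitianmxP; rewrite expr0 scale1r AE. Qed.

Lemma unitary_adjK n (Q : 'M[C]_n) : Q \is unitarymx -> Q^t* *m Q = 1%:M.
Proof.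
by move=> Qu; rewrite -invmx_unitary// mulVmx// unitarymx_unit.
Qed.

Lemma unitary_Kadj n (Q : 'M[C]_n) : Q \is unitarymx -> Q *m Q^t* = 1%:M.
Proof. by move=> /unitarymxP. Qed.

Lemma adj_unitary n (Q : 'M[C]_n) : Q^t* *m Q = 1%:M -> Q \is unitarymx.
Proof. by move=> QQ; rewrite -trmxC_unitary; apply/unitarymxP; rewrite adjK. Qed.

Lemma unitary_normE n (Q : 'M[C]_n) (v : 'cV[C]_n) : Q \is unitarymx ->
  (Q *m v)^t* *m (Q *m v) = v^t* *m v.
Proof.
by move=> Qu; rewrite adjM mulmxA -(mulmxA _ _ Q) unitary_adjK// mulmx1.
Qed.

Lemma tens1 m n : (1%:M : 'M[C]_m) *t (1%:M : 'M[C]_n) = 1%:M.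
Proof.
apply/matrixP => i j; case: (mxtens_indexP i) => a b.
case: (mxtens_indexP j) => c d; rewrite tensmxE !mxE -natrM mulnb.
by rewrite (can_eq (@mxtens_indexK _ _)).
Qed.

Lemma tens_unitary m n (P : 'M[C]_m) (Q : 'M[C]_n) :
  P \is unitarymx -> Q \is unitarymx -> P *t Q \is unitarymx.
Proof.
move=> Pu Qu; apply: adj_unitary.
by rewrite adj_tens tensmx_mul !unitary_adjK// tens1.
Qed.

(** * Quadratic forms and diagonalization in a unitary basis *)

Definition qform n (A : 'M[C]_n) (v : 'cV[C]_n) : R :=
  complex.Re ((v^t* *m A *m v) 0 0).

Definition psd n (A : 'M[C]_n) := A^t* = A /\ forall v, 0 <= qform A v.

Lemma qformD n (A B : 'M[C]_n) v : qform (A + B) v = qform A v + qform B v.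
Proof.
by rewrite /qform mulmxDr mulmxDl mxE; case: (X in X + _) => ? ?; case: (X in _ + X).
Qed.

Lemma qformZ n (x : R) (A : 'M[C]_n) v : qform (x%:C *: A) v = x * qform A v.
Proof. by rewrite /qform -scalemxAr -scalemxAl mxE ReM_real. Qed.

Lemma qformN n (A : 'M[C]_n) v : qform (- A) v = - qform A v.
Proof. by rewrite /qform mulmxN mulNmx mxE; case: (X in - X). Qed.

Lemma qformB n (A B : 'M[C]_n) v : qform (A - B) v = qform A v - qform B v.
Proof. by rewrite qformD qformN. Qed.

Lemma qform_sum n I (r : seq I) (P : pred I) (F : I -> 'M[C]_n) v :
  qform (\sum_(i <- r | P i) F i) v = \sum_(i <- r | P i) qform (F i) v.
Proof.
have q0 : qform (0 : 'M[C]_n) v = 0 by rewrite /qform mulmx0 mul0mx mxE.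
exact: (big_morph (fun A : 'M[C]_n => qform A v) (fun A B => qformD A B v) q0).
Qed.

Lemma adj_mul_sqn n (v : 'cV[C]_n) : (v^t* *m v) 0 0 = (\sum_k sqn (v k 0))%:C.
Proof.
rewrite mxE rmorph_sum; apply: eq_bigr => k _.
by rewrite adjE mul_conj_sqn.
Qed.

(* [udiag Q d] has the rows of Q as (conjugated) eigenvectors when Q is
   unitary; this is the shape produced by [herm_fun]. *)
Definition udiag n (Q : 'M[C]_n) (d : 'I_n -> R) : 'M[C]_n :=
  Q^t* *m diag_mx (\row_k (d k)%:C) *m Q.

Lemma adj_diag_real n (d : 'I_n -> R) :
  (diag_mx (\row_k (d k)%:C))^t* = diag_mx (\row_k (d k)%:C).
Proof.
apply/matrixP => i j; rewrite !mxE eq_sym.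
by case: eqVneq => [->|_]; rewrite ?mulr1n ?mulr0n ?conjCE ?conjc_real// rmorph0.
Qed.

Lemma adj_udiag n (Q : 'M[C]_n) d : (udiag Q d)^t* = udiag Q d.
Proof.
rewrite /udiag; move: (adj_diag_real d); move: (diag_mx _) => D DE.
by rewrite adjM adjM adjK DE mulmxA.
Qed.

Lemma qform_udiag n (Q : 'M[C]_n) d v :
  qform (udiag Q d) v = \sum_k d k * sqn ((Q *m v) k 0).
Proof.
rewrite /qform /udiag !mulmxA -adjM -(mulmxA _ Q v); set u := Q *m v.
rewrite mul_mx_diag mxE Re_sum; apply: eq_bigr => k _.
by rewrite mxE adjE [X in _ * X * _]mxE mulrAC mul_conj_sqn ReM_real mulrC.
Qed.

Lemma conj_unitaryM n (Q D E : 'M[C]_n) : Q \is unitarymx ->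
  (Q^t* *m D *m Q) *m (Q^t* *m E *m Q) = Q^t* *m (D *m E) *m Q.
Proof.
move=> /unitary_Kadj; move: (Q^t*) => P QP.
by rewrite !mulmxA -(mulmxA _ Q P) QP mulmx1.
Qed.

Lemma udiagM n (Q : 'M[C]_n) d e : Q \is unitarymx ->
  udiag Q d *m udiag Q e = udiag Q (fun k => d k * e k).
Proof.
move=> Qu; have DE : diag_mx (\row_k (d k * e k)%:C) =
    diag_mx (\row_k (d k)%:C) *m diag_mx (\row_k (e k)%:C) :> 'M[C]_n.
  by rewrite mulmx_diag; congr diag_mx; apply/rowP => k; rewrite !mxE rmorphM.
by rewrite /udiag DE; exact: conj_unitaryM.
Qed.

Lemma tr_udiag n (Q : 'M[C]_n) d : Q \is unitarymx ->
  \tr (udiag Q d) = (\sum_k d k)%:C.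
Proof.
move=> Qu; rewrite /udiag mxtrace_mulC mulmxA unitary_Kadj// mul1mx.
by rewrite mxtrace_diag rmorph_sum; apply: eq_bigr => k _; rewrite mxE.
Qed.

Lemma udiag_tens m n (P : 'M[C]_m) (Q : 'M[C]_n) d e :
  udiag P d *t udiag Q e = udiag (P *t Q)
    (fun k => d (mxtens_unindex k).1 * e (mxtens_unindex k).2).
Proof.
rewrite /udiag.
have -> : diag_mx (\row_k (d (mxtens_unindex k).1 * e (mxtens_unindex k).2)%:C) =
    diag_mx (\row_k (d k)%:C) *t diag_mx (\row_k (e k)%:C) :> 'M[C]_(m * n).
  apply/matrixP => i j; case: (mxtens_indexP i) => a b.
  case: (mxtens_indexP j) => a' b'; rewrite tensmxE !mxE !mxtens_indexK/=.
  rewrite (can_eq (@mxtens_indexK _ _)) xpair_eqE rmorphM.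
  by case: eqVneq => _; case: eqVneq => _;
    rewrite ?(mulr1n, mulr0n, mul0r, mulr0).
move: (diag_mx _) => D; move: (diag_mx _) => E.
by rewrite adj_tens !tensmx_mul.
Qed.

Lemma udiag_const n (Q : 'M[C]_n) (x : R) : Q \is unitarymx ->
  udiag Q (fun=> x) = x%:C%:M.
Proof.
move=> Qu; rewrite /udiag.
have -> : diag_mx (\row_(k < n) x%:C) = x%:C%:M.
  by apply/matrixP => i j; rewrite !mxE.
by rewrite mul_mx_scalar -scalemxAl unitary_adjK// scalemx1.
Qed.

Lemma herm_fun_udiag n (f : R -> R) (Q : 'M[C]_n) d : Q \is unitarymx ->
  herm_fun (fun x => (f x)%:C) (udiag Q d) = udiag Q (f \o d).
Proof. by move=> Qu; rewrite herm_funE. Qed.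

Lemma hermitian_udiag n (A : 'M[C]_n) : A^t* = A ->
  exists2 Q, Q \is unitarymx & exists d, A = udiag Q d.
Proof.
move=> /adj_hermsym Ah; exists (spectralmx A); first exact: spectral_unitarymx.
exists (fun k => complex.Re (spectral_diag A 0 k)); rewrite /udiag.
have -> : \row_k (complex.Re (spectral_diag A 0 k))%:C = spectral_diag A.
  apply/rowP => k; rewrite mxE RRe_real//.
  by have /mxOverP := hermitian_spectral_diag_real Ah; apply.
rewrite -invmx_unitary ?spectral_unitarymx//.
exact: orthomx_spectralP (hermitian_normalmx Ah).
Qed.

Definition eigvec n (Q : 'M[C]_n) k : 'cV[C]_n := Q^t* *m delta_mx k 0.

Lemma udiag_eigvec n (Q : 'M[C]_n) d k : Q \is unitarymx ->
  udiag Q d *m eigvec Q k = (d k)%:C *: eigvec Q k.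
Proof.
move=> Qu; rewrite /udiag /eigvec mulmxA -(mulmxA _ Q) unitary_Kadj// mulmx1.
rewrite -mulmxA scalemxAr; congr (_ *m _); rewrite mul_diag_mx.
by apply/matrixP => i j; rewrite !mxE; case: eqVneq => [->|]; rewrite ?mulr0.
Qed.

Lemma qform_eigvec n (Q : 'M[C]_n) d k : Q \is unitarymx ->
  qform (udiag Q d) (eigvec Q k) = d k.
Proof.
move=> Qu; rewrite qform_udiag /eigvec mulmxA unitary_Kadj// mul1mx.
rewrite (bigD1 k)//= big1 => [|i ik].
  by rewrite /sqn !mxE !eqxx/= expr0n expr1n !addr0 mulr1.
by rewrite /sqn !mxE (negPf ik)/= expr0n addr0 mulr0.
Qed.

Lemma psd_udiag n (Q : 'M[C]_n) d : Q \is unitarymx ->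
  psd (udiag Q d) <-> forall k, 0 <= d k.
Proof.
move=> Qu; split=> [[_ d0] k|d0]; first by rewrite -(qform_eigvec d k Qu).
split=> [|v]; first exact: adj_udiag.
by rewrite qform_udiag sumr_ge0// => k _; rewrite mulr_ge0 ?sqn_ge0.
Qed.

(** Difference of squares without commutativity: B^2 - A^2 = B(B - A) + (B - A)A. The eigenvector
    equation is used on the right of the first product and, by hermiticity, on the left of the
    second. *)
Lemma qform_comm n (A B : 'M[C]_n) (v : 'cV[C]_n) (x : R) :
  A^t* = A -> B^t* = B -> (B - A) *m v = x%:C *: v ->
  qform (B *m B) v - qform (A *m A) v = x * (qform B v + qform A v).
Proof.
move=> Ah Bh vE; rewrite -qformB.
have -> : B *m B - A *m A = B *m (B - A) + (B - A) *m A.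
  by rewrite mulmxBr mulmxBl addrA subrK.
rewrite qformD mulrDr; congr (_ + _).
  by rewrite /qform mulmxA -[_ *m v]mulmxA vE -scalemxAr mxE ReM_real.
have vE' : v^t* *m (B - A) = x%:C *: v^t*.
  by rewrite -[LHS]adjK adjM adjB Ah Bh adjK vE adjZ_real.
by rewrite /qform mulmxA vE' -!scalemxAl mxE ReM_real.
Qed.

(* An eigenvalue x of B - A with eigenvector v satisfies
   x (<v,Bv> + <v,Av>) = <v,B^2 v> - <v,A^2 v> >= 0. *)
Lemma sqrt_monotone n (A B : 'M[C]_n) : psd A -> psd B ->
  (forall v, qform (A *m A) v <= qform (B *m B) v) ->
  forall v, qform A v <= qform B v.
Proof.
move=> [Ah A0] [Bh B0] AB v; rewrite -subr_ge0 -qformB.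
have [|Q Qu [d dE]] := @hermitian_udiag _ (B - A); first by rewrite adjB Ah Bh.
rewrite dE; apply: (proj2 (proj2 (psd_udiag d Qu) _)) => k.
rewrite leNgt; apply/negP => dk; set v0 := eigvec Q k.
have := @qform_comm _ A B v0 (d k) Ah Bh.
rewrite {1}dE udiag_eigvec// => /(_ erefl) e.
have := AB v0; rewrite -subr_ge0 e nmulr_rge0// => AB0.
have := qform_eigvec d k Qu; rewrite -dE qformB -/v0 => dkE.
have := A0 v0; have := B0 v0; move: AB0 dkE dk.
by move: (qform A v0) (qform B v0) (d k) => x y z; clear; lra.
Qed.

End Adjoint.

(** * Scalar inequalities *)

Section Scalar.
Context {R : realType}.
Implicit Types (r w e x : R).

(** This is 1 + y <= exp y at y = e ln x. It lets monotonicity of small powers stand in for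
    monotonicity of the logarithm. *)
Lemma ln_le_powR x e : 0 < x -> 0 < e -> ln x <= (x `^ e - 1) / e.
Proof.
move=> x0 e0; rewrite ler_pdivlMr// /powR gt_eqF//.
by have := expR_ge1Dx (e * ln x); lra.
Qed.

(** Concavity: the graph of w^e lies below its tangent at r. *)
Lemma powR_tangent r w e : 0 < r -> 0 <= w -> 0 < e <= 1 ->
  w `^ e <= r `^ e * (1 + e * (w / r - 1)).
Proof.
move=> r0; rewrite le_eqVlt => /orP[/eqP<- /andP[e0 e1]|w0 /andP[e0 e1]].
  rewrite powR0 ?gt_eqF// mul0r sub0r mulr_ge0 ?powR_ge0//; lra.
have -> : w `^ e = r `^ e * (w / r) `^ e.
  by rewrite -powRM ?ltW// ?divr_gt0// mulrC divfK// gt_eqF.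
rewrite ler_wpM2l ?powR_ge0// /powR gt_eqF ?divr_gt0//.
set x := w / r; have x0 : 0 < x by rewrite divr_gt0.
have -> : x = expR (ln x) by rewrite lnK.
rewrite expRK; move: (ln x) => y.
(* Two instances of 1 + u <= exp u; weighted by e and 1 - e, their terms linear in y cancel. *)
have h1 : expR (e * y) * (1 + (1 - e) * y) <= expR y.
  have -> : expR y = expR (e * y) * expR ((1 - e) * y).
    by rewrite -expRD; congr expR; ring.
  by rewrite ler_wpM2l ?expR_ge0// expR_ge1Dx.
have h2 : expR (e * y) * (1 - e * y) <= 1.
  rewrite -[leRHS](expRxMexpNx_1 (e * y)).
  by rewrite ler_wpM2l ?expR_ge0// expR_ge1Dx.
have : e * (expR (e * y) * (1 + (1 - e) * y)) <= e * expR y by rewrite ler_pM2l.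
have : (1 - e) * (expR (e * y) * (1 - e * y)) <= 1 - e.
  by rewrite -[leRHS]mulr1 ler_wpM2l// subr_ge0.
by nra.
Qed.

(** In the limit e -> 0 this reads r ln w <= r ln r + w - r. The tangent at r gives it up to factors
    r^e, and the last summand pays for replacing them by 1. *)
Lemma klein_scalar r w e : 0 <= r <= 1 -> 0 <= w -> 0 < e <= 1 ->
  r * ((w `^ e - 1) / e) <=
    r * ln r + (w - r) + e * (r * ln r ^+ 2 - r * ln r).
Proof.
move=> /andP[r0 r1] w0 /[dup] /andP[e0 e1] e01.
move: r0; rewrite le_eqVlt => /orP[/eqP<-|r0].
  by rewrite !mul0r; lra.
have := powR_tangent r0 w0 e01.
have : ln r <= 0 by rewrite -ln1 ler_ln// posrE.
move=> L0; have : r `^ e <= 1.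
  by rewrite /powR gt_eqF// -expR0 ler_expR mulr_ge0_le0// ltW.
move: L0; have := expR_ge1Dx (e * ln r); have := expR_ge1Dx (- (e * ln r)).
have -> : expR (- (e * ln r)) = (r `^ e)^-1 by rewrite expRN /powR gt_eqF.
have -> : expR (e * ln r) = r `^ e by rewrite /powR gt_eqF.
have := powR_gt0 e r0; move: (r `^ e) (ln r) (w `^ e) => p L W.
move=> p0 hi hp L0 p1 hW.
(* With p = r^e and L = ln r, this is exp(-eL) >= 1 - eL multiplied by p. *)
have h1 : p - 1 <= e * (p * L).
  have : p * (1 + - (e * L)) <= 1.
    by rewrite -[leRHS](divff (lt0r_neq0 p0)) ler_wpM2l// ltW.
  by lra.
have hrW : r * (W - 1) / e <= r * (p * L) + p * (w - r).
  rewrite ler_pdivrMr//.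
  have : r * W <= p * (r + e * (w - r)).
    have -> : p * (r + e * (w - r)) = r * (p * (1 + e * (w / r - 1))).
      by field; exact: lt0r_neq0.
    by rewrite ler_pM2l.
  have : r * (p - 1) <= r * (e * (p * L)) by rewrite ler_pM2l.
  by lra.
rewrite mulrA; apply: le_trans hrW _.
have h2 : p * L <= (1 + e * L) * L by rewrite ler_wnM2r.
have : r * (p * L) <= r * ((1 + e * L) * L) by rewrite ler_pM2l.
have : (1 - p) * r <= - (e * L) * r by rewrite ler_pM2r//; lra.
have : 0 <= (1 - p) * w by rewrite mulr_ge0 ?subr_ge0.
by lra.
Qed.

(** From ln x <= x - 1 at x = r/s; the pointwise form of the chi-square bound on relative
    entropy. *)
Lemma xlnx_le r s : 0 <= r -> 0 < s -> r * ln r <= r * ln s + (r ^+ 2 / s - r).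
Proof.
rewrite le_eqVlt => /orP[/eqP<- s0|r0 s0].
  by rewrite !mul0r expr0n/= mul0r subr0 addr0.
have := expR_ge1Dx (ln (r / s)); rewrite lnK ?posrE ?divr_gt0//.
rewrite lnM ?posrE ?invr_gt0// lnV ?posrE// => h.
have : r * (ln r - ln s) <= r * (r / s - 1) by rewrite ler_pM2l//; lra.
by lra.
Qed.

(* Klein's inequality Tr(rho log omega) <= Tr(rho log rho) and
   S(rho || sigma) <= Tr(rho^2 sigma^-1) - 1, read in eigenbases; x and y are
   the squared moduli of the overlaps, and log is replaced by (t^e - 1)/e to
   allow for zero eigenvalues of omega. *)
Lemma klein_sums n (x y : 'I_n -> 'I_n -> R) (r w s : 'I_n -> R) e :
  (forall a b, 0 <= x a b) -> (forall a b, 0 <= y a b) ->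
  (forall a, \sum_b x a b = 1) -> (forall b, \sum_a x a b = 1) ->
  (forall a, \sum_b y a b = 1) ->
  (forall a, 0 <= r a) -> \sum_a r a = 1 ->
  (forall b, 0 <= w b) -> \sum_b w b = 1 ->
  (forall k, 0 < s k) -> 0 < e <= 1 ->
  (\sum_b (\sum_a r a * x a b) * w b `^ e - 1) / e <=
    \sum_k (\sum_a r a * y a k) * ln (s k)
    + \sum_k (\sum_a r a ^+ 2 * y a k) / s k - 1
    + e * \sum_a (r a * ln (r a) ^+ 2 - r a * ln (r a)).
Proof.
move=> x0 y0 xr xc yr r0 r1 w0 w1 s0 e01.
have rle1 a : 0 <= r a <= 1.
  by rewrite r0 -r1 (bigD1 a)//= lerDl sumr_ge0.
have -> : (\sum_b (\sum_a r a * x a b) * w b `^ e - 1) / e =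
    \sum_a \sum_b x a b * (r a * ((w b `^ e - 1) / e)).
  have -> : \sum_b (\sum_a r a * x a b) * w b `^ e - 1 =
      \sum_a \sum_b x a b * (r a * (w b `^ e - 1)).
    rewrite -[X in _ - X]r1; under eq_bigr do rewrite mulr_suml.
    rewrite exchange_big/= -sumrB; apply: eq_bigr => a _.
    have rE : r a = \sum_b r a * x a b by rewrite -mulr_sumr xr mulr1.
    rewrite [X in _ - X]rE -sumrB.
    by apply: eq_bigr => b _; ring.
  rewrite mulr_suml; apply: eq_bigr => a _; rewrite mulr_suml.
  by apply: eq_bigr => b _; rewrite !mulrA.
apply: (@le_trans _ _ (\sum_a \sum_b x a b *
   (r a * ln (r a) + (w b - r a) + e * (r a * ln (r a) ^+ 2 - r a * ln (r a))))).
  do 2 (apply: ler_sum => ? _); rewrite ler_wpM2l// klein_scalar//.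
have -> : \sum_a \sum_b x a b *
   (r a * ln (r a) + (w b - r a) + e * (r a * ln (r a) ^+ 2 - r a * ln (r a)))
   = \sum_a r a * ln (r a)
     + e * \sum_a (r a * ln (r a) ^+ 2 - r a * ln (r a)).
  (* Row sums of [x] remove [b] from the [r] terms, column sums remove [a] from the [w] terms; the
     totals of [w] and [r] are both 1 and cancel. *)
  transitivity (\sum_a ((r a * ln (r a) - r a
     + e * (r a * ln (r a) ^+ 2 - r a * ln (r a))) + \sum_b x a b * w b)).
    apply: eq_bigr => a _; rewrite -[X in _ = X + _]mul1r -(xr a) mulr_suml.
    by rewrite -big_split; apply: eq_bigr => b _ /=; ring.
  rewrite big_split/= exchange_big/=.
  under [X in _ + X]eq_bigr do rewrite -mulr_suml xc mul1r.
  by rewrite w1 big_split/= sumrB r1 -mulr_sumr; ring.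
rewrite lerD2r.
have -> : \sum_k (\sum_a r a * y a k) * ln (s k)
    + \sum_k (\sum_a r a ^+ 2 * y a k) / s k - 1
    = \sum_a \sum_k y a k * (r a * ln (s k) + (r a ^+ 2 / s k - r a)).
  rewrite -big_split/= -[X in _ - X]r1.
  under eq_bigr do rewrite 2!mulr_suml -big_split.
  rewrite exchange_big/= -sumrB; apply: eq_bigr => a _.
  have rE : r a = \sum_k r a * y a k by rewrite -mulr_sumr yr mulr1.
  rewrite [X in _ - X]rE -sumrB; apply: eq_bigr => k _ /=.
  by ring.
apply: ler_sum => a _; rewrite -[leLHS]mul1r -(yr a) mulr_suml.
by apply: ler_sum => k _; rewrite ler_wpM2l// xlnx_le.
Qed.

End Scalar.

(** * Bounds on the relative entropy of entanglement of a pure state *)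

Section PureState.
Context {R : realType}.
Local Notation C := R[i].

Lemma density_udiag n (rho : 'M[C]_n) : density rho ->
  exists2 Q, Q \is unitarymx & exists2 d, rho = udiag Q d &
    (forall k, 0 <= d k) /\ \sum_k d k = 1.
Proof.
move=> [/hermsym_adj rhoh rho0 tr1].
have [Q Qu [d dE]] := hermitian_udiag rhoh.
exists Q => //; exists d => //; split=> [k|].
  have := rho0 (eigvec Q k); rewrite lecE /= => /andP[_].
  by rewrite -/(qform rho _) dE qform_eigvec.
by move: tr1; rewrite dE tr_udiag// => -[].
Qed.

Lemma udiag_density n (Q : 'M[C]_n) d : Q \is unitarymx ->
  (forall k, 0 <= d k) -> \sum_k d k = 1 -> density (udiag Q d).
Proof.
move=> Qu d0 d1; split; last by rewrite tr_udiag// d1.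
  exact/adj_hermsym/adj_udiag.
move=> v; have [h q0] := proj2 (psd_udiag d Qu) d0; rewrite lecE /=.
apply/andP; split; last exact: q0.
(* The order on complex numbers also demands a zero imaginary part, which holds because this 1 x 1
   matrix is its own adjoint. *)
have : (v^t* *m udiag Q d *m v)^t* = v^t* *m udiag Q d *m v.
  by rewrite adjM adjM adjK h mulmxA.
move: (_ *m v) => z /matrixP/(_ 0 0); rewrite adjE; case: (z 0 0) => a b [] hb.
by apply/eqP => /=; lra.
Qed.

Lemma qform_tens_ge0 m n (P : 'M[C]_m) (Q : 'M[C]_n) d e v :
  (forall k, 0 <= d k) -> (forall k, 0 <= e k) ->
  0 <= qform (udiag P d *t udiag Q e) v.
Proof.
move=> d0 e0; rewrite udiag_tens qform_udiag sumr_ge0// => k _.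
by rewrite !mulr_ge0 ?sqn_ge0.
Qed.

Lemma udiag_compl n (Q : 'M[C]_n) d : Q \is unitarymx ->
  1%:M - udiag Q d = udiag Q (fun k => 1 - d k).
Proof.
move=> Qu; have <- : udiag Q (fun=> 1) = 1%:M by rewrite udiag_const.
have DE : diag_mx (\row_k (1 - d k)%:C) =
    diag_mx (\row_k 1%:C) - diag_mx (\row_k (d k)%:C) :> 'M[C]_n.
  by rewrite -raddfB; congr diag_mx; apply/rowP => k; rewrite !mxE rmorphB.
by rewrite /udiag DE mulmxBr mulmxBl.
Qed.

Lemma tensDl m n p q (A B : 'M[C]_(m, n)) (D : 'M[C]_(p, q)) :
  (A + B) *t D = A *t D + B *t D.
Proof. by apply/matrixP => i j; rewrite !mxE mulrDl. Qed.

Lemma tensBr m n p q (A : 'M[C]_(m, n)) (B D : 'M[C]_(p, q)) :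
  A *t (B - D) = A *t B - A *t D.
Proof. by apply/matrixP => i j; rewrite !mxE mulrBr. Qed.

Lemma tensZl m n p q (x : C) (A : 'M[C]_(m, n)) (D : 'M[C]_(p, q)) :
  (x *: A) *t D = x *: (A *t D).
Proof. by apply/matrixP => i j; rewrite !mxE mulrA. Qed.

Lemma tens_suml m n p q N (F : 'I_N -> 'M[C]_(m, n)) (D : 'M[C]_(p, q)) :
  (\sum_k F k) *t D = \sum_k (F k *t D).
Proof.
have t0 : (0 : 'M[C]_(m, n)) *t D = 0 by exact: tens0mx.
exact: (big_morph (fun A : 'M[C]_(m, n) => A *t D) (fun A B => tensDl A B D) t0).
Qed.

Lemma tens1r_psd m n (P : 'M[C]_m) d : P \is unitarymx ->
  (forall k, 0 <= d k) -> psd (udiag P d *t (1%:M : 'M[C]_n)).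
Proof.
move=> Pu d0; have u1 : (1%:M : 'M[C]_n) \is unitarymx.
  by apply: adj_unitary; rewrite adj1 mul1mx.
have <- : udiag 1%:M (fun=> 1) = (1%:M : 'M[C]_n) by rewrite udiag_const.
rewrite udiag_tens; apply/(psd_udiag _ (tens_unitary Pu u1)) => k.
by rewrite mulr_ge0.
Qed.

Lemma density_convex n N (p : 'I_N -> R) (rho : 'I_N -> 'M[C]_n) :
  (forall k, 0 <= p k) -> \sum_k p k = 1 -> (forall k, density (rho k)) ->
  density (\sum_k (p k)%:C *: rho k).
Proof.
move=> p0 p1 drho; split.
- apply: adj_hermsym; rewrite adj_sum; apply: eq_bigr => k _.
  by rewrite adjZ_real hermsym_adj//; case: (drho k).
- move=> v; rewrite mulmx_sumr mulmx_suml summxE sumr_ge0// => k _.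
  rewrite -scalemxAr -scalemxAl mxE mulr_ge0 ?lecR//.
  by case: (drho k).
- rewrite raddf_sum/= -(rmorph1 (real_complex R)) -p1 rmorph_sum.
  apply: eq_bigr => k _; rewrite mxtraceZ.
  by have [_ _ ->] := drho k; rewrite mulr1.
Qed.

(* The reduction criterion: tau <= 1 gives rho (x) tau <= rho (x) 1. *)
Lemma separable_reduction dA dB (sigma : 'M[C]_(dA * dB)) : separable sigma ->
  psd sigma /\ exists2 omega : 'M[C]_dA, density omega &
    forall v, qform sigma v <= qform (omega *t (1%:M : 'M[C]_dB)) v.
Proof.
move=> [N [p [rho [tau [p0 p1 dens ->]]]]]; split.
  split.
    rewrite adj_sum; apply: eq_bigr => k _; rewrite adjZ_real adj_tens.
    by have [[/hermsym_adj-> _ _] [/hermsym_adj-> _ _]] := dens k.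
  move=> v; rewrite qform_sum sumr_ge0// => k _; rewrite qformZ mulr_ge0//.
  have [/density_udiag[P Pu [d -> [d0 _]]]] := dens k.
  by move=> /density_udiag[Q Qu [e -> [e0 _]]]; exact: qform_tens_ge0.
exists (\sum_k (p k)%:C *: rho k).
  by apply: density_convex => // k; case: (dens k).
move=> v; rewrite tens_suml !qform_sum; apply: ler_sum => k _.
rewrite tensZl !qformZ; apply: ler_wpM2l => //.
rewrite -subr_ge0 -qformB -tensBr.
have [/density_udiag[P Pu [d -> [d0 _]]]] := dens k.
move=> /density_udiag[Q Qu [e -> [e0 e1]]]; rewrite udiag_compl//.
apply: qform_tens_ge0 => // j.
by rewrite subr_ge0 -e1 (bigD1 j)//= lerDl sumr_ge0.
Qed.

(** The exponents reached from 1 by iterating the square root; they serve as the parameter e of the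
    power approximation to the logarithm. *)
Definition dyadic n : R := 2^-1 ^+ n.

Lemma dyadic_gt0 n : 0 < dyadic n.
Proof. by rewrite exprn_gt0// invr_gt0. Qed.

Lemma dyadic_le1 n : dyadic n <= 1.
Proof. by rewrite exprn_ile1// ?invr_ge0// invf_le1// ler1n. Qed.

Lemma powR_dyadic n (x : R) : x `^ dyadic n.+1 * x `^ dyadic n.+1 = x `^ dyadic n.
Proof.
rewrite -powRD; last by rewrite gt_eqF ?implybT//= addr_gt0 ?dyadic_gt0.
by congr (_ `^ _); rewrite /dyadic exprS; field.
Qed.

(** Both sides at exponent 2^-(n+1) square to the sides at 2^-n, the identity factor squaring to
    itself, so [sqrt_monotone] carries the induction. *)
Lemma powR_dyadic_monotone dA dB (Q : 'M[C]_(dA * dB)) d (P : 'M[C]_dA) w n :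
  Q \is unitarymx -> P \is unitarymx ->
  (forall k, 0 <= d k) -> (forall k, 0 <= w k) ->
  (forall v, qform (udiag Q d) v <= qform (udiag P w *t (1%:M : 'M[C]_dB)) v) ->
  forall v, qform (udiag Q (fun k => d k `^ dyadic n)) v <=
    qform (udiag P (fun k => w k `^ dyadic n) *t (1%:M : 'M[C]_dB)) v.
Proof.
move=> Qu Pu d0 w0 dw; elim: n => [|n IHn].
  have pw N (f : 'I_N -> R) : (forall k, 0 <= f k) ->
      (fun k => f k `^ dyadic 0) = f.
    by move=> f0; apply/funext => k; exact: powRr1.
  by rewrite !pw.
have sq N (U : 'M[C]_N) (f : 'I_N -> R) : U \is unitarymx ->
    udiag U (fun k => f k `^ dyadic n.+1) *m udiag U (fun k => f k `^ dyadic n.+1)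
    = udiag U (fun k => f k `^ dyadic n).
  by move=> Uu; rewrite (udiagM _ _ Uu) (funext (fun k => powR_dyadic n (f k))).
apply: sqrt_monotone.
- by apply/(psd_udiag _ Qu) => k; exact: powR_ge0.
- by apply: tens1r_psd => // k; exact: powR_ge0.
- by move=> v; rewrite tensmx_mul mulmx1 (sq _ _ _ Qu) (sq _ _ _ Pu).
Qed.

(** * Reduced states and overlaps of eigenbases *)

Lemma udiag_diagE n (V : 'M[C]_n) r k :
  (udiag V r) k k = (\sum_a r a * sqn (V a k))%:C.
Proof.
rewrite /udiag mul_mx_diag mxE rmorph_sum; apply: eq_bigr => a _.
by rewrite mxE adjE mxE mulrAC mul_conj_sqn rmorphM mulrC.
Qed.

Lemma udiag_conj n (V Z : 'M[C]_n) r : Z^t* *m udiag V r *m Z = udiag (V *m Z) r.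
Proof.
rewrite /udiag; move: (diag_mx _) => D.
by rewrite adjM !mulmxA.
Qed.

Lemma unitary_col_sqn n (Q : 'M[C]_n) b : Q \is unitarymx ->
  \sum_a sqn (Q a b) = 1.
Proof.
move=> Qu; apply: (@complexI R).
have := udiag_diagE Q (fun=> 1) b; rewrite udiag_const// mxE eqxx mulr1n => ->.
by congr _%:C; apply: eq_bigr => a _; rewrite mul1r.
Qed.

Lemma unitary_row_sqn n (Q : 'M[C]_n) a : Q \is unitarymx ->
  \sum_b sqn (Q a b) = 1.
Proof.
rewrite -trmxC_unitary => /(@unitary_col_sqn _ _ a) <-.
apply: eq_bigr => b _; rewrite adjE /sqn; case: (Q a b) => x y /=.
by rewrite sqrrN.
Qed.

Lemma unitary_mul n (P Q : 'M[C]_n) :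
  P \is unitarymx -> Q \is unitarymx -> P *m Q \is unitarymx.
Proof.
move=> Pu Qu; apply: adj_unitary.
by rewrite adjM mulmxA -(mulmxA _ _ P) unitary_adjK// mulmx1 unitary_adjK.
Qed.

Lemma sum_mxtens (V : nmodType) m n (F : 'I_(m * n) -> V) :
  \sum_i F i = \sum_(k < m) \sum_(l < n) F (mxtens_index (k, l)).
Proof.
rewrite pair_big /= (reindex (@mxtens_index m n)) /=.
  by apply: eq_bigr => -[].
by exists (@mxtens_unindex m n) => i _; rewrite ?mxtens_indexK ?mxtens_unindexK.
Qed.

Definition coef_mx dA dB (a : 'cV[C]_(dA * dB)) : 'M[C]_(dA, dB) :=
  \matrix_(k, l) a (mxtens_index (k, l)) 0.

(** The partial trace over B of the projector on [a]: if M is the matrix of amplitudes, it is M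
    times its adjoint. *)
Definition reduced dA dB (a : 'cV[C]_(dA * dB)) : 'M[C]_dA :=
  coef_mx a *m (coef_mx a)^t*.

Lemma qform_reduced dA dB (X : 'M[C]_dA) (a : 'cV[C]_(dA * dB)) :
  qform (X *t (1%:M : 'M[C]_dB)) a = complex.Re (\tr (X *m reduced a)).
Proof.
rewrite /qform -mulmxA; congr complex.Re; rewrite mxE sum_mxtens.
apply: eq_bigr => k _; rewrite /reduced mxE.
under [RHS]eq_bigr do rewrite mxE mulr_sumr.
rewrite exchange_big/=; apply: eq_bigr => l _.
rewrite adjE mxE sum_mxtens mulr_sumr; apply: eq_bigr => k' _.
rewrite (bigD1 l)//= big1 => [|l' ll'].
  by rewrite tensmxE !mxE eqxx mulr1 addr0 conjCE; ring.
by rewrite tensmxE mxE eq_sym (negPf ll') mulr0 mul0r.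
Qed.

Lemma adj_reduced dA dB (a : 'cV[C]_(dA * dB)) : (reduced a)^t* = reduced a.
Proof. by rewrite /reduced adjM adjK. Qed.

Lemma reduced_diagE dA dB (a : 'cV[C]_(dA * dB)) k :
  complex.Re (reduced a k k) = \sum_l sqn (a (mxtens_index (k, l)) 0).
Proof.
rewrite /reduced mxE Re_sum; apply: eq_bigr => l _.
by rewrite adjE mulrC mul_conj_sqn mxE.
Qed.

Lemma reduced_sqr_diagE dA dB (a : 'cV[C]_(dA * dB)) k :
  complex.Re ((reduced a *m reduced a) k k) = \sum_m sqn (reduced a k m).
Proof.
rewrite mxE Re_sum; apply: eq_bigr => m _.
by rewrite -{2}adj_reduced adjE mulrC mul_conj_sqn.
Qed.

Lemma unit_sqn n (v : 'cV[C]_n) : v^t* *m v = 1%:M -> \sum_k sqn (v k 0) = 1.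
Proof.
move=> /matrixP/(_ 0 0); rewrite adj_mul_sqn mxE eqxx => h.
by apply: (@complexI R); rewrite h.
Qed.

Lemma reduced_udiag dA dB (a : 'cV[C]_(dA * dB)) : a^t* *m a = 1%:M ->
  exists2 V, V \is unitarymx & exists2 r, reduced a = udiag V r &
    (forall k, 0 <= r k) /\ \sum_k r k = 1.
Proof.
move=> a1; have [V Vu [r rE]] := hermitian_udiag (adj_reduced a).
exists V => //; exists r => //; split.
  apply/(psd_udiag r Vu); rewrite -rE; split; first exact: adj_reduced.
  move=> v; rewrite /qform /reduced mulmxA -mulmxA -[v^t* *m _]adjK adjM !adjK.
  by rewrite adj_mul_sqn sumr_ge0// => k _; exact: sqn_ge0.
have := congr1 (@complex.Re R) (tr_udiag r Vu); rewrite -rE /= => <-.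
rewrite /mxtrace Re_sum; under eq_bigr do rewrite reduced_diagE.
by rewrite -(unit_sqn a1) sum_mxtens.
Qed.

(** Only the squared overlaps of the two eigenbases enter; they form a doubly stochastic matrix, the
    [x] of [klein_sums]. *)
Lemma tr_udiagM n (P V : 'M[C]_n) w r :
  complex.Re (\tr (udiag P w *m udiag V r)) =
  \sum_b (\sum_a r a * sqn ((V *m P^t*) a b)) * w b.
Proof.
have trC (D G : 'M[C]_n) : \tr (P^t* *m D *m P *m G) = \tr (P *m G *m P^t* *m D).
  by rewrite -mulmxA mxtrace_mulC mulmxA.
rewrite {1}/udiag trC.
have -> : P *m udiag V r *m P^t* = udiag (V *m P^t*) r.
  by rewrite -udiag_conj adjK.
rewrite mul_mx_diag /mxtrace Re_sum; apply: eq_bigr => b _.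
by rewrite mxE udiag_diagE [X in _ * X]mxE ReM_real.
Qed.

(** [UB] meets only the identity on B and cancels against its adjoint. *)
Lemma local_unitary_tens1 dA dB (UA X : 'M[C]_dA) (UB : 'M[C]_dB) a :
  UB \is unitarymx ->
  qform (X *t (1%:M : 'M[C]_dB)) ((UA *t UB) *m a) =
  qform ((UA^t* *m X *m UA) *t (1%:M : 'M[C]_dB)) a.
Proof.
move=> Bu; have <- : (UA *t UB)^t* *m (X *t 1%:M) *m (UA *t UB) =
    (UA^t* *m X *m UA) *t (1%:M : 'M[C]_dB).
  by rewrite adj_tens !tensmx_mul mulmx1 unitary_adjK.
by rewrite /qform adjM !mulmxA.
Qed.

(** Writing v v^* = D sigma and multiplying by v^* on the left and Q^* on the right exhibits the
    factor [d k] in coordinate k. Zero eigenvalues, where ln takes its default value, thus carry no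
    weight. *)
Lemma support_udiag n (Q : 'M[C]_n) d (v : 'cV[C]_n) k : Q \is unitarymx ->
  v^t* *m v = 1%:M -> (v *m v^t* <= udiag Q d)%MS -> d k = 0 ->
  (Q *m v) k 0 = 0.
Proof.
move=> Qu v1 /submxP[D vE] dk.
have : v^t* *m Q^t* = v^t* *m D *m Q^t* *m diag_mx (\row_k (d k)%:C).
  rewrite -{1}[v^t*]mul1mx -v1 -(mulmxA _ v) vE /udiag.
  move: (diag_mx _) => E.
  by rewrite !mulmxA -(mulmxA _ Q) unitary_Kadj// mulmx1.
rewrite -adjM mul_mx_diag => /matrixP/(_ 0 k).
rewrite adjE mxE [X in _ * X]mxE dk mulr0 => /eqP.
by rewrite conjc_eq0 => /eqP.
Qed.

(** Since n <= 2^n, the error drops below x - y once n > K / (x - y). This is how the exponent is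
    sent to 0. *)
Lemma le_of_dyadic (x y K : R) : (forall n, x <= y + dyadic n * K) -> x <= y.
Proof.
move=> h; rewrite leNgt; apply/negP => yx.
have K0 : 0 < K by have := h 0; rewrite /dyadic expr0; lra.
pose n := Num.bound (K / (x - y)).
have := @archi_boundP R (K / (x - y)); rewrite divr_ge0 ?subr_ge0 ?ltW// => /(_ isT).
rewrite -/n ltr_pdivrMr ?subr_gt0// => hn.
have n2 : n%:R <= 2 ^+ n :> R by rewrite -natrX ler_nat ltnW// ltn_expl.
have := h n; rewrite /dyadic exprVn -lerBlDl ler_pdivlMl ?exprn_gt0//.
apply/negP; rewrite -ltNge; apply: lt_le_trans hn _.
by rewrite ler_wpM2r// subr_ge0 ltW.
Qed.

(** For e = 2^-n: the logarithm is bounded by (sigma^e - 1)/e, sigma^e by omega^e (x) 1, whose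
    expectation only sees the reduced state, and [klein_sums] trades omega for [s]. *)
Lemma qform_ln_separable dA dB (UA : 'M[C]_dA) (UB : 'M[C]_dB)
    (a : 'cV[C]_(dA * dB)) (s : 'I_dA -> R) (Q : 'M[C]_(dA * dB)) d :
  UA \is unitarymx -> UB \is unitarymx -> Q \is unitarymx ->
  a^t* *m a = 1%:M -> (forall k, 0 < s k) -> separable (udiag Q d) ->
  let v := (UA *t UB) *m a in
  (v *m v^t* <= udiag Q d)%MS ->
  qform (udiag Q (fun k => ln (d k))) v <=
    \sum_k complex.Re (reduced a k k) * ln (s k)
    + \sum_k complex.Re ((reduced a *m reduced a) k k) / s k - 1.
Proof.
move=> Au Bu Qu a1 s0 /separable_reduction[/(psd_udiag d Qu) d0].
move=> [omega /density_udiag[P Pu [w -> [w0 w1]]] red] v vd.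
have v1 : v^t* *m v = 1%:M.
  by rewrite /v unitary_normE ?tens_unitary.
have [V Vu [r rE [r0 r1]]] := reduced_udiag a1.
have PAu := unitary_mul Pu Au.
have PAu' : (P *m UA)^t* \is unitarymx by rewrite trmxC_unitary.
(* The constant is the factor of e in [klein_sums]; it depends on the spectrum of the reduced state
   alone. *)
apply: (@le_of_dyadic _ _ (\sum_k (r k * ln (r k) ^+ 2 - r k * ln (r k)))) => n.
set e := dyadic n; have e0 : 0 < e := dyadic_gt0 n.
apply: (@le_trans _ _ ((qform (udiag Q (fun k => d k `^ e)) v - 1) / e)).
  rewrite 2!(qform_udiag Q).
  have Qv1 : \sum_k sqn ((Q *m v) k 0) = 1.
    by apply: unit_sqn; rewrite unitary_normE.
  rewrite -[X in _ - X]Qv1 -sumrB mulr_suml; apply: ler_sum => k _ /=.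
  have := d0 k; rewrite le_eqVlt => /orP[/eqP/esym dk|dk].
    by rewrite (support_udiag Qu v1 vd dk) /sqn/= expr0n addr0 !mulr0 subr0 mul0r.
  rewrite -[X in _ - X]mul1r -mulrBl mulrAC ler_wpM2r ?sqn_ge0//.
  exact: ln_le_powR.
have := powR_dyadic_monotone n Qu Pu d0 w0 red v; rewrite -/e.
rewrite (local_unitary_tens1 _ _ _ Bu) udiag_conj qform_reduced rE tr_udiagM.
move: (V *m (P *m UA)^t*) (unitary_mul Vu PAu') => W Wu h.
apply: (@le_trans _ _
    ((\sum_b (\sum_a0 r a0 * sqn (W a0 b)) * w b `^ e - 1) / e)).
  by rewrite ler_pM2r ?invr_gt0// lerD2r.
(* [y] holds the overlaps of the eigenbasis of the reduced state with the standard basis, in which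
   [s] is diagonal. *)
apply: le_trans (klein_sums (y := fun a k => sqn (V a k)) _ _ _ _ _ r0 r1 w0 w1 s0 _) _.
- by move=> *; exact: sqn_ge0.
- by move=> *; exact: sqn_ge0.
- by move=> k; exact: unitary_row_sqn Wu.
- by move=> k; exact: unitary_col_sqn Wu.
- by move=> k; exact: unitary_row_sqn Vu.
- by rewrite e0 dyadic_le1.
rewrite lerD2r (udiagM _ _ Vu).
under [X in _ <= X + _ - _]eq_bigr do rewrite udiag_diagE /=.
under [X in _ <= _ + X - _]eq_bigr do rewrite udiag_diagE /=.
by rewrite le_eqVlt; apply/orP; left; apply/eqP.
Qed.

(** * Product-diagonal states and relative entropy of a pure state *)

Lemma udiag_sum n (Q : 'M[C]_n) N (c : 'I_N -> R) (f : 'I_N -> 'I_n -> R) :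
  udiag Q (fun k => \sum_j c j * f j k) = \sum_j (c j)%:C *: udiag Q (f j).
Proof.
have DE : diag_mx (\row_k (\sum_j c j * f j k)%:C) =
    \sum_j (c j)%:C *: diag_mx (\row_k (f j k)%:C) :> 'M[C]_n.
  apply/matrixP => i j; rewrite summxE !mxE rmorph_sum -sumrMnl.
  by apply: eq_bigr => k _; rewrite !mxE rmorphM mulrnAr.
rewrite /udiag DE mulmx_sumr mulmx_suml; apply: eq_bigr => j _.
by rewrite -scalemxAr -scalemxAl.
Qed.

(** The spectral decomposition is itself a separable one: [f j] and [g j] are indicators, giving the
    two rank-one factors of the j-th product projector. *)
Lemma udiag_separable dA dB (P : 'M[C]_dA) (Q : 'M[C]_dB) q :
  P \is unitarymx -> Q \is unitarymx -> (forall j, 0 <= q j) ->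
  \sum_j q j = 1 -> separable (udiag (P *t Q) q).
Proof.
move=> Pu Qu q0 q1.
pose f (j : 'I_(dA * dB)) k : R := ((mxtens_unindex j).1 == k)%:R.
pose g (j : 'I_(dA * dB)) l : R := ((mxtens_unindex j).2 == l)%:R.
have sum_delta N (i : 'I_N) : \sum_k (i == k)%:R = 1 :> R.
  by rewrite (bigD1 i)//= eqxx big1 ?addr0// => k; rewrite eq_sym => /negPf->.
exists (dA * dB)%N, q, (fun j => udiag P (f j)), (fun j => udiag Q (g j)).
split=> //; first move=> j.
  by split; apply: udiag_density => // *; rewrite /f /g ?ler0n ?sum_delta.
transitivity (udiag (P *t Q) (fun k => \sum_j q j * (j == k)%:R)).
  congr udiag; apply/funext => k; rewrite (bigD1 k)//= eqxx mulr1 big1 ?addr0//.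
  by move=> j /negPf->; rewrite mulr0.
rewrite udiag_sum; apply: eq_bigr => j _; rewrite udiag_tens; congr (_ *: udiag _ _).
apply/funext => k; rewrite /f /g -natrM mulnb -xpair_eqE -!surjective_pairing.
by rewrite (can_eq (@mxtens_unindexK _ _)).
Qed.

Lemma logmx_udiag b n (Q : 'M[C]_n) d : Q \is unitarymx ->
  logmx b (udiag Q d) = udiag Q (fun k => logb b (d k)).
Proof. by move=> Qu; rewrite /logmx herm_fun_udiag. Qed.

(** A projector has eigenvalues 0 and 1, and both logarithms are 0, the first by convention. *)
Lemma logmx_pure b n (v : 'cV[C]_n) : v^t* *m v = 1%:M -> logmx b (v *m v^t*) = 0.
Proof.
move=> v1; have vh : (v *m v^t*)^t* = v *m v^t* by rewrite adjM adjK.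
have [Q Qu [d dE]] := hermitian_udiag vh.
have : udiag Q d *m udiag Q d = udiag Q d.
  by rewrite -dE mulmxA -(mulmxA v) v1 mulmx1.
rewrite (udiagM _ _ Qu) dE (logmx_udiag _ _ Qu) => dd.
have d01 k : logb b (d k) = 0.
  have := qform_eigvec (fun k => d k * d k) k Qu; rewrite dd (qform_eigvec _ _ Qu).
  move=> /esym/eqP; rewrite -subr_eq0 -{3}[d k]mulr1 -mulrBr mulf_eq0 subr_eq0.
  by case/orP => /eqP->; rewrite /logb ?ln1 ?(ln0 (lexx 0)) mul0r.
by rewrite (funext d01) (udiag_const _ Qu) raddf0.
Qed.

Lemma relative_entropy_pure b n (v : 'cV[C]_n) (Q : 'M[C]_n) d :
  Q \is unitarymx -> v^t* *m v = 1%:M ->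
  relative_entropy b (v *m v^t*) (udiag Q d) =
  if (v *m v^t* <= udiag Q d)%MS
  then (- (qform (udiag Q (fun k => ln (d k))) v / ln b))%:E else +oo%E.
Proof.
move=> Qu v1; rewrite /relative_entropy; case: ifP => // _; congr (_%:E).
rewrite (logmx_pure _ v1) (logmx_udiag _ _ Qu) sub0r mulmxN raddfN /=.
rewrite -mulmxA mxtrace_mulC /mxtrace big_ord1.
have -> : complex.Re (- (v^t* *m udiag Q (fun k => logb b (d k)) *m v) 0 0) =
    - qform (udiag Q (fun k => logb b (d k))) v.
  by rewrite /qform; case: (X in - X).
by rewrite 2!(qform_udiag Q) mulr_suml; congr (- _); apply: eq_bigr => k _;
  rewrite /logb mulrAC.
Qed.

(** * Two-sided bounds from amplitudes in a fixed product basis *)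

Section Bounds.
Variables (b : R) (dA dB : nat) (UA : 'M[C]_dA) (UB : 'M[C]_dB).
Variables (a : 'cV[C]_(dA * dB)).
Hypotheses (b1 : 1 < b) (Au : UA \is unitarymx) (Bu : UB \is unitarymx).
Hypothesis a1 : a^t* *m a = 1%:M.
Let v := (UA *t UB) *m a.

Let v1 : v^t* *m v = 1%:M.
Proof.
by rewrite /v unitary_normE ?tens_unitary.
Qed.

Lemma ree_lower s : (forall k, 0 < s k) ->
  (((1 - \sum_k complex.Re (reduced a k k) * ln (s k)
    - \sum_k (\sum_m sqn (reduced a k m)) / s k) / ln b)%:E
   <= relative_entropy_of_entanglement b (v *m v^t*))%E.
Proof.
have aux (x y z : R) : x <= y + z - 1 -> 1 - y - z <= - x by lra.
move=> s0; apply/ereal_infP => _ [sigma sep <-].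
have [[sh _] _] := separable_reduction sep.
have [Q Qu [d dE]] := hermitian_udiag sh; rewrite dE in sep *.
rewrite (relative_entropy_pure _ _ Qu v1); case: ifPn => [vd|_]; last exact: leey.
have := qform_ln_separable Au Bu Qu a1 s0 sep vd.
under [X in _ + X - _]eq_bigr do rewrite reduced_sqr_diagE.
rewrite lee_fin -mulNr ler_pM2r ?invr_gt0 ?ln_gt0// -/v.
exact: aux.
Qed.

Lemma ree_upper q : (forall j, 0 < q j) -> \sum_j q j = 1 ->
  (relative_entropy_of_entanglement b (v *m v^t*)
   <= (- (\sum_j ln (q j) * sqn (a j 0)) / ln b)%:E)%E.
Proof.
move=> q0 q1; have Uu := tens_unitary Au Bu.
(* Adjoints appear because [udiag] takes conjugated eigenvectors as rows, while the basis vectors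
   are the columns of [UA] and [UB]. *)
have Uu' : UA^t* *t UB^t* \is unitarymx by rewrite -adj_tens trmxC_unitary.
have sep : separable (udiag (UA^t* *t UB^t*) q).
  by apply: udiag_separable; rewrite ?trmxC_unitary// => j; exact: ltW.
apply: (@le_trans _ _ (relative_entropy b (v *m v^t*) (udiag (UA^t* *t UB^t*) q))).
  by apply: ereal_inf_lbound; exists (udiag (UA^t* *t UB^t*) q).
rewrite (relative_entropy_pure _ _ Uu' v1) ifT; last first.
  (* Positive weights make the comparison state invertible, so the support condition is
     automatic. *)
  apply: submx_full; rewrite row_full_unit.
  have : udiag (UA^t* *t UB^t*) q *m udiag (UA^t* *t UB^t*) (fun j => (q j)^-1) = 1%:M.
    rewrite (udiagM _ _ Uu').
    have -> : (fun k => q k * (q k)^-1) = (fun=> 1).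
      by apply/funext => k; rewrite divff// gt_eqF.
    by rewrite udiag_const.
  by move=> e1; exact: (proj1 (mulmx1_unit e1)).
rewrite lee_fin qform_udiag /v mulmxA -adj_tens (unitary_adjK Uu) mul1mx.
by rewrite mulNr.
Qed.

Lemma fine_ree s q : (forall k, 0 < s k) -> (forall j, 0 < q j) -> \sum_j q j = 1 ->
  (1 - \sum_k complex.Re (reduced a k k) * ln (s k)
    - \sum_k (\sum_m sqn (reduced a k m)) / s k) / ln b
  <= fine (relative_entropy_of_entanglement b (v *m v^t*))
  <= - (\sum_j ln (q j) * sqn (a j 0)) / ln b.
Proof.
move=> s0 q0 q1; have := ree_lower s0; have := ree_upper q0 q1.
(* The finite bounds exclude both infinite values, so [fine] acts on a real number. *)
by case: relative_entropy_of_entanglement => [x| |]; rewrite ?lee_fin// => -> ->.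
Qed.

End Bounds.

End PureState.

(** * Comparison with the cross entropy *)

Section Perturbation.
Context {R : realType}.
Local Notation C := R[i].
Local Notation normc := (@Normc.normc R).

(** * Moduli, and static comparison of two amplitude vectors *)

Lemma sqn_normc (z : C) : sqn z = normc z ^+ 2.
Proof. by case: z => x y; rewrite /sqn /= sqr_sqrtr// addr_ge0 ?sqr_ge0. Qed.

Lemma normc_ge0 (z : C) : 0 <= normc z.
Proof. by case: z => x y; exact: sqrtr_ge0. Qed.

Lemma normc_conj (z : C) : normc z^*%C = normc z.
Proof. by case: z => x y /=; rewrite sqrrN. Qed.

Lemma normc_sum I (r : seq I) (P : pred I) (F : I -> C) :
  normc (\sum_(i <- r | P i) F i) <= \sum_(i <- r | P i) normc (F i).
Proof.
elim/big_ind2: _ => //; first by rewrite Normc.normc0.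
by move=> x1 x2 y1 y2 h1 h2; apply: le_trans (le_normcD _ _) _; exact: lerD.
Qed.

Lemma normc_unit n (v : 'cV[C]_n) k : v^t* *m v = 1%:M -> normc (v k 0) <= 1.
Proof.
move=> /unit_sqn v1; rewrite -(@ler_pXn2r _ 2)// ?nnegrE ?normc_ge0//.
rewrite expr1n -sqn_normc -v1 (bigD1 k)//= lerDl sumr_ge0// => i _.
exact: sqn_ge0.
Qed.

Section Static.
Variables (dA dB : nat) (a a0 : 'cV[C]_(dA * dB)).
Hypotheses (a1 : a^t* *m a = 1%:M) (a01 : a0^t* *m a0 = 1%:M).

Definition cross_entropy : R := - \sum_j sqn (a j 0) * ln (sqn (a0 j 0)).

Let p k := complex.Re (reduced a0 k k).

(** What the lower bound needs of Schmidt amplitudes: the reduced state is diagonal, and each row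
    puts its whole weight on a single entry. *)
Definition schmidt_form :=
  (forall k m, k != m -> reduced a0 k m = 0) /\
  (forall k l, sqn (a0 (mxtens_index (k, l)) 0) = 0 \/
     sqn (a0 (mxtens_index (k, l)) 0) = p k).

(** Only zero weights are changed; leaving the others exact makes the first-order terms cancel in
    [cross_entropy_le]. *)
Definition regularized (d : R) k := if p k == 0 then d else p k.

Let pE k : p k = \sum_l sqn (a0 (mxtens_index (k, l)) 0).
Proof. exact: reduced_diagE. Qed.

Let p_ge0 k : 0 <= p k.
Proof. by rewrite pE sumr_ge0// => l _; exact: sqn_ge0. Qed.

Let p_sum : \sum_k p k = 1.
Proof. by under eq_bigr do rewrite pE; rewrite -(unit_sqn a01) sum_mxtens. Qed.

Let p_le1 k : p k <= 1.
Proof. by rewrite -p_sum (bigD1 k)//= lerDl sumr_ge0. Qed.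

Lemma regularized_gt0 d k : 0 < d -> 0 < regularized d k.
Proof.
move=> d0; rewrite /regularized; case: eqVneq => // pk.
by rewrite lt_neqAle eq_sym pk p_ge0.
Qed.

(** Completing the square around [a0]: on the diagonal |x|^2 - |x - p|^2 = p (2 Re x - p). Divided
    by p and summed over k this is 2 - 1 = 1, which uses up the constant and leaves a quadratic
    error. *)
Lemma cross_entropy_le d : schmidt_form -> 0 < d <= 1 ->
  cross_entropy - \sum_k (\sum_m sqn (reduced a k m - reduced a0 k m)) / regularized d k
  <= 1 - \sum_k complex.Re (reduced a k k) * ln (regularized d k)
     - \sum_k (\sum_m sqn (reduced a k m)) / regularized d k.
Proof.
move=> [diag0 w0] /andP[d0 d1]; set s := regularized d.
have s0 k : 0 < s k by exact: regularized_gt0.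
(* Termwise comparison: a zero weight of [a0] contributes ln 0 = 0 on the right, and [ln (s k) <= 0]
   there; otherwise the logarithms agree. *)
have entropy : \sum_k complex.Re (reduced a k k) * ln (s k) <= - cross_entropy.
  rewrite /cross_entropy opprK [leRHS]sum_mxtens; apply: ler_sum => k _.
  rewrite reduced_diagE mulr_suml; apply: ler_sum => l _.
  rewrite ler_wpM2l ?sqn_ge0//.
  have [->|->] := w0 k l.
    rewrite [leRHS]ln0// -ln1 ler_ln ?posrE// /s /regularized.
    by case: ifP.
  rewrite /s /regularized; case: eqVneq => // ->.
  by rewrite [leRHS]ln0// -ln1 ler_ln ?posrE.
have sqE k : \sum_m sqn (reduced a k m) / s k <=
    \sum_m sqn (reduced a k m - reduced a0 k m) / s k
    + (2 * complex.Re (reduced a k k) - p k).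
  rewrite (bigD1 k)//= [X in _ <= X + _](bigD1 k)//=.
  have -> : \sum_(m | m != k) sqn (reduced a k m - reduced a0 k m) / s k =
      \sum_(m | m != k) sqn (reduced a k m) / s k.
    by apply: eq_bigr => m mk; rewrite diag0 ?subr0// eq_sym.
  rewrite addrAC lerD2r -lerBlDl -mulrBl.
  have -> : sqn (reduced a k k) - sqn (reduced a k k - reduced a0 k k) =
      p k * (2 * complex.Re (reduced a k k) - p k).
    have : complex.Im (reduced a0 k k) = 0.
      by rewrite /reduced mxE Im_sum big1// => l _; rewrite adjE mulrC mul_conj_sqn.
    rewrite /sqn /p; case: (reduced a k k) => x y.
    by case: (reduced a0 k k) => u w /= ->; ring.
  (* If [p k] is 0 the left side vanishes and the right is twice a nonnegative weight; otherwise
     [s k] is [p k] and the sides are equal. *)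
  rewrite /s /regularized; case: eqVneq => [->|pk].
    rewrite !mul0r subr0 mulr_ge0// reduced_diagE sumr_ge0// => l _.
    exact: sqn_ge0.
  by rewrite mulrAC divff// mul1r.
have : \sum_k (\sum_m sqn (reduced a k m)) / s k <=
    \sum_k (\sum_m sqn (reduced a k m - reduced a0 k m)) / s k + 1.
  have e1 : \sum_k (2 * complex.Re (reduced a k k) - p k) = 1.
    rewrite sumrB p_sum -mulr_sumr.
    under eq_bigr do rewrite reduced_diagE.
    by have := unit_sqn a1; rewrite sum_mxtens => ->; ring.
  rewrite -[X in _ <= _ + X]e1 -big_split; apply: ler_sum => k _ /=.
  by rewrite !mulr_suml.
move: entropy; move: (\sum_k _) (\sum_k _) (\sum_k _) cross_entropy => x y z u.
by lra.
Qed.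

(** [q] adds [d] to every initial weight and normalizes. Normalization costs ln(1 + N d) <= N d, and
    -ln d is paid only where the initial weight is zero. *)
Lemma cross_entropy_ge d : 0 < d <= 1 ->
  let N : R := (dA * dB)%:R in
  let q j := (sqn (a0 j 0) + d) / (1 + N * d) in
  [/\ forall j, 0 < q j, \sum_j q j = 1 &
    - \sum_j ln (q j) * sqn (a j 0) <=
    cross_entropy + N * d - ln d * \sum_(j | sqn (a0 j 0) == 0) sqn (a j 0)].
Proof.
move=> /andP[d0 d1] N q.
have N0 : 0 <= N by rewrite ler0n.
have Nd0 : 0 < 1 + N * d by rewrite ltr_pwDl// mulr_ge0// ltW.
have w0 j : 0 <= sqn (a0 j 0) := sqn_ge0 _.
split=> [j||].
- by rewrite divr_gt0// ltr_wpDl.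
- rewrite -mulr_suml big_split/= (unit_sqn a01) sumr_const card_ord -mulr_natl.
  by rewrite divff// gt_eqF.
rewrite [X in _ - _ * X]big_mkcond/= mulr_sumr /cross_entropy.
rewrite -[X in _ + X - _]mulr1 -(unit_sqn a1) mulr_sumr -!sumrN -!big_split/=.
apply: ler_sum => j _.
have hq : - ln (q j) <= - ln (sqn (a0 j 0)) + N * d
    - (if sqn (a0 j 0) == 0 then ln d else 0).
  have sd0 : 0 < sqn (a0 j 0) + d by rewrite ltr_wpDl.
  rewrite /q lnM ?posrE ?invr_gt0// lnV ?posrE// opprB.
  have : ln (1 + N * d) <= N * d.
    by apply: le_ln1Dx; rewrite (lt_le_trans (ltrN10 _))// mulr_ge0// ltW.
  case: eqVneq => [->|wj]; first by rewrite add0r (ln0 (lexx 0)); lra.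
  have : ln (sqn (a0 j 0)) <= ln (sqn (a0 j 0) + d).
    by rewrite ler_ln ?posrE// ?lerDl ?ltW// lt_neqAle eq_sym wj w0.
  by lra.
have := ler_wpM2r (sqn_ge0 (a j 0)) hq.
by case: eqP => _; rewrite ?subr0 ?mulr0 ?subr0; lra.
Qed.

End Static.

(** Each product of amplitudes changes by one factor at a time, the other factor having modulus at
    most 1. *)
Lemma reduced_lipschitz dA dB (a a0 : 'cV[C]_(dA * dB)) e k m :
  a^t* *m a = 1%:M -> a0^t* *m a0 = 1%:M ->
  (forall j, normc (a j 0 - a0 j 0) <= e) ->
  normc (reduced a k m - reduced a0 k m) <= dB%:R * (2 * e).
Proof.
move=> a1 a01 ae; rewrite /reduced [X in X - _]mxE [X in _ - X]mxE -sumrB.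
apply: le_trans (normc_sum _ _ _) _.
rewrite -[X in X%:R * _]card_ord mulr_natl -sumr_const; apply: ler_sum => l _.
rewrite !adjE !mxE.
set i := mxtens_index (k, l); set j := mxtens_index (m, l).
have := ae i; have := ae j; have := normc_unit i a1; have := normc_unit j a01.
move: (a i 0) (a j 0) (a0 i 0) (a0 j 0) => x y x0 y0 hy0 hx hy hx0.
have -> : x * y^*%C - x0 * y0^*%C = x * (y - y0)^*%C + (x - x0) * y0^*%C.
  by rewrite rmorphB /=; ring.
apply: le_trans (le_normcD _ _) _; rewrite !Normc.normcM !normc_conj.
rewrite mulr_natl mulr2n; apply: lerD.
  by rewrite -[leRHS]mul1r ler_pM ?normc_ge0.
by rewrite -[leRHS]mulr1 ler_pM ?normc_ge0.
Qed.

(** * Trigonometric sums in time and their derivatives *)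

Lemma normr_sin_le (x : R) : `|sin x| <= `|x|.
Proof.
wlog x0 : x / 0 <= x.
  move=> h; have [/h//|/ltW x0] := leP 0 x.
  by have := h (- x); rewrite oppr_ge0 sinN !normrN; exact.
move: x0; rewrite le_eqVlt => /orP[/eqP<-|x0]; first by rewrite sin0.
have [c _] := @MVT R sin cos 0 x x0 (fun y _ => is_derive_sin y)
  (continuous_subspaceT (@continuous_sin R)).
rewrite sin0 !subr0 => ->; rewrite normrM -[leRHS]mul1r ler_wpM2r//.
by rewrite ler_norml cos_geN1 cos_le1.
Qed.

Lemma normr_cosB1_le (x : R) : `|cos x - 1| <= `|x|.
Proof.
wlog x0 : x / 0 <= x.
  move=> h; have [/h//|/ltW x0] := leP 0 x.
  by have := h (- x); rewrite oppr_ge0 cosN normrN; exact.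
move: x0; rewrite le_eqVlt => /orP[/eqP<-|x0]; first by rewrite cos0 subrr.
have [c _] := @MVT R cos (fun y => - sin y) 0 x x0 (fun y _ => is_derive_cos y)
  (continuous_subspaceT (@continuous_cos R)).
rewrite cos0 !subr0 => ->; rewrite normrM -[leRHS]mul1r ler_wpM2r//.
by rewrite normrN ler_norml sin_geN1 sin_le1.
Qed.

(** The shape of an amplitude of exp(-iHt) psi: [d] lists the eigenvalues of H and [x] the products
    of overlaps with its eigenvectors. *)
Definition phase_sum n (x : 'I_n -> C) (d : 'I_n -> R) (t : R) : C :=
  \sum_m x m * (cos (- t * d m) +i* sin (- t * d m)).

Lemma phase_sum0 n (x : 'I_n -> C) d : phase_sum x d 0 = \sum_m x m.
Proof.
apply: eq_bigr => m _.
by rewrite oppr0 mul0r cos0 sin0 mulr1.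
Qed.

Lemma phase_sum_lipschitz n (x : 'I_n -> C) d t :
  normc (phase_sum x d t - phase_sum x d 0) <=
  (\sum_m normc (x m) * (2 * `|d m|)) * `|t|.
Proof.
rewrite phase_sum0 /phase_sum -sumrB; apply: le_trans (normc_sum _ _ _) _.
rewrite mulr_suml; apply: ler_sum => m _.
rewrite -[X in _ - X]mulr1 -mulrBr Normc.normcM -mulrA ler_wpM2l ?normc_ge0//.
set th := - t * d m.
(* The factor 2 comes from bounding |cos - 1| and |sin| separately by the angle. *)
have -> : 2 * `|d m| * `|t| = `|th| + `|th|.
  by rewrite /th normrM normrN; ring.
have := normr_sin_le th; have := normr_cosB1_le th => hc hs.
have -> : (cos th +i* sin th)%C - 1 = (cos th - 1)%:C + (sin th)*i%C.
  by apply/eqP; rewrite eq_complex /=; apply/andP; split; apply/eqP; ring.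
apply: le_trans (le_normcD _ _) _.
by rewrite /= expr0n/= addr0 add0r !sqrtr_sqr lerD.
Qed.

Lemma is_derive_lin (d : R) : is_derive (0 : R) 1 (fun t : R => - t * d) (- d).
Proof.
have -> : (fun t : R => - t * d) = (- d) \*: (@id R).
  by apply/funext => t /=; rewrite /GRing.scale /=; ring.
by apply: is_derive_eq; rewrite /GRing.scale /= mulr1.
Qed.

Lemma is_derive_trig (u v d : R) :
  is_derive (0 : R) 1 (fun t : R => u * cos (- t * d) + v * sin (- t * d)) (- (v * d)).
Proof.
have hl := is_derive_lin d.
have hc : is_derive (0 : R) 1 (cos \o (fun t : R => - t * d)) (- sin (- 0 * d) * - d).
  exact: is_derive1_comp.
have hs : is_derive (0 : R) 1 (sin \o (fun t : R => - t * d)) (cos (- 0 * d) * - d).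
  exact: is_derive1_comp.
rewrite oppr0 mul0r sin0 oppr0 mul0r in hc.
rewrite oppr0 mul0r cos0 mul1r in hs.
have -> : (fun t : R => u * cos (- t * d) + v * sin (- t * d)) =
    (u \*: (cos \o (fun t : R => - t * d))) + (v \*: (sin \o (fun t : R => - t * d))).
  by [].
apply: is_derive_eq; rewrite /GRing.scale /=; ring.
Qed.

(** The phase sum has value z and derivative -i w at 0, so its squared modulus has derivative 2
    Re(conj(z) (-i w)) = 2 Im(conj(z) w). *)
Lemma is_derive_sqn_phase_sum n (x : 'I_n -> C) d :
  let z := \sum_m x m in let w := \sum_m x m * (d m)%:C in
  is_derive (0 : R) 1 (fun t => sqn (phase_sum x d t))
    (2 * (complex.Re z * complex.Im w - complex.Im z * complex.Re w)).
Proof.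
move=> z w.
pose f := \sum_m (fun t : R => complex.Re (x m) * cos (- t * d m)
  + - complex.Im (x m) * sin (- t * d m)).
pose g := \sum_m (fun t : R => complex.Im (x m) * cos (- t * d m)
  + complex.Re (x m) * sin (- t * d m)).
have fE t : complex.Re (phase_sum x d t) = f t.
  rewrite /f fct_sumE Re_sum; apply: eq_bigr => m _.
  by case: (x m) => u v /=; ring.
have gE t : complex.Im (phase_sum x d t) = g t.
  rewrite /g fct_sumE Im_sum; apply: eq_bigr => m _.
  by case: (x m) => u v /=; ring.
have df : is_derive (0 : R) 1 f (complex.Im w).
  have -> : complex.Im w = \sum_m - (- complex.Im (x m) * d m).
    rewrite /w Im_sum; apply: eq_bigr => m _.
    by case: (x m) => u v /=; ring.
  by apply: is_derive_sum => m; exact: is_derive_trig.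
have dg : is_derive (0 : R) 1 g (- complex.Re w).
  have -> : - complex.Re w = \sum_m - (complex.Re (x m) * d m).
    rewrite /w Re_sum -sumrN; apply: eq_bigr => m _.
    by case: (x m) => u v /=; ring.
  by apply: is_derive_sum => m; exact: is_derive_trig.
clearbody f g.
have -> : (fun t => sqn (phase_sum x d t)) = f * f + g * g.
  by apply/funext => t; rewrite /sqn fE gE !expr2.
have h := is_deriveD (is_deriveM df df) (is_deriveM dg dg).
apply: (@is_derive_eq _ _ _ _ _ _ _ _ h).
rewrite /GRing.scale /= -fE -gE phase_sum0 -/z.
by ring.
Qed.

(** The bound forces e 0 = 0, and the difference quotient is then at most K sqrt|t|. *)
Lemma is_derive_small (e : R -> R) K :
  (forall t, `|t| <= 1 -> `|e t| <= K * (`|t| * Num.sqrt `|t|)) ->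
  is_derive (0 : R) 1 e 0.
Proof.
move=> eK.
have e0 : e 0 = 0.
  have := eK 0; rewrite normr0 sqrtr0 !mulr0 ler01 => /(_ isT).
  by rewrite normr_le0 => /eqP.
have K0 : 0 <= K.
  have := eK 1; rewrite normr1 sqrtr1 !mulr1 lexx => /(_ isT).
  exact: le_trans.
have lim0 : ((fun h => h^-1 *: ((e \o shift 0) (h *: (1 : R)) - e 0)) @ (0 : R)^'
    --> (0 : R))%classic.
  apply/cvgr0Pnorm_lt => r r0.
  near=> h.
  have h0 : h != 0 by near: h; exact: nbhs_dnbhs_neq.
  (* The square undoes the square root, and K + 1 keeps the denominator positive when K = 0. *)
  have hsmall : `|h| < Num.min 1 ((r / (K + 1)) ^+ 2).
    near: h; apply: dnbhs0_lt.
    by rewrite lt_min ltr01 exprn_gt0// divr_gt0// ltr_wpDl.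
  move: hsmall; rewrite lt_min => /andP[h1 h2].
  rewrite /= e0 subr0 addr0 /GRing.scale /= mulr1 normrM normfV.
  rewrite mulrC ltr_pdivrMr ?normr_gt0//.
  apply: le_lt_trans (eK _ (ltW h1)) _.
  rewrite mulrA mulrAC ltr_pM2r ?normr_gt0//.
  have hs : Num.sqrt `|h| < r / (K + 1).
    have rK : 0 < r / (K + 1) by rewrite divr_gt0// ltr_wpDl.
    have <- : Num.sqrt ((r / (K + 1)) ^+ 2) = r / (K + 1).
      by rewrite sqrtr_sqr gtr0_norm.
    by rewrite ltr_sqrt// exprn_gt0.
  apply: (@le_lt_trans _ _ ((K + 1) * Num.sqrt `|h|)).
    by rewrite ler_wpM2r ?sqrtr_ge0// lerDl.
  by rewrite mulrC -ltr_pdivlMr// ltr_wpDl.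
apply: DeriveDef; first by apply/cvg_ex; exists 0.
exact: cvg_lim.
Unshelve. all: by end_near.
Qed.

(** * The entanglement curve near time 0 *)

Section Curve.
Variables (b : R) (dA dB : nat) (UA : 'M[C]_dA) (UB : 'M[C]_dB).
Variables (alpha : R -> 'cV[C]_(dA * dB)) (K : R).
Hypotheses (b1 : 1 < b) (Au : UA \is unitarymx) (Bu : UB \is unitarymx).
Hypothesis alpha1 : forall t, (alpha t)^t* *m alpha t = 1%:M.
Hypothesis alphaK : forall t j, normc (alpha t j 0 - alpha 0 j 0) <= K * `|t|.
Hypothesis schmidt0 : schmidt_form (alpha 0).

Let F t := fine (relative_entropy_of_entanglement b
  (((UA *t UB) *m alpha t) *m ((UA *t UB) *m alpha t)^t*)).

Let lnb_gt0 : 0 < ln b. Proof. by rewrite ln_gt0. Qed.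

(** The reduced state moves by O(|t|), so the chi-square error is O(t^2) times the largest inverse
    of the regularized weights. *)
Lemma ree_curve_ge : exists2 K1, 0 <= K1 &
  forall t d, 0 < d <= 1 ->
  cross_entropy (alpha t) (alpha 0) - K1 * `|t| ^+ 2 * (1 + d^-1) <= F t * ln b.
Proof.
pose p k := complex.Re (reduced (alpha 0) k k).
(* Bounds every inverse weight; a zero weight adds 0 here, its inverse being 0 by convention, and is
   covered by 1/d. *)
pose M := \sum_k `|(p k)^-1|.
have M0 : 0 <= M by rewrite sumr_ge0.
pose K0 := dA%:R * (dB%:R * (2 * K)) ^+ 2.
have K00 : 0 <= K0 by rewrite mulr_ge0 ?ler0n ?sqr_ge0.
exists (dA%:R * (K0 * (1 + M))).
  by rewrite mulr_ge0 ?ler0n// mulr_ge0// addr_ge0.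
move=> t d /[dup] d01 /andP[d0 d1].
have s0 k : 0 < regularized (alpha 0) d k by exact: regularized_gt0.
have [q0 q1 _] := cross_entropy_ge (alpha1 t) (alpha1 0) d01.
have /andP[+ _] := fine_ree b1 Au Bu (alpha1 t) s0 q0 q1.
rewrite -/(F t) ler_pdivrMr//; apply: le_trans.
apply: le_trans (cross_entropy_le (alpha1 t) (alpha1 0) schmidt0 d01).
rewrite lerD2l lerN2.
have -> : dA%:R * (K0 * (1 + M)) * `|t| ^+ 2 * (1 + d^-1) =
    \sum_(k < dA) (K0 * `|t| ^+ 2) * ((1 + M) * (1 + d^-1)).
  by rewrite sumr_const card_ord -mulr_natl; ring.
apply: ler_sum => k _; apply: ler_pM.
- by rewrite sumr_ge0// => m _; exact: sqn_ge0.
- by rewrite invr_ge0 ltW.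
- rewrite /K0 -mulrA -exprMn -[X in X%:R * _]card_ord mulr_natl -sumr_const.
  apply: ler_sum => m _.
  have := reduced_lipschitz k m (alpha1 t) (alpha1 0) (alphaK t).
  have -> : dB%:R * (2 * (K * `|t|)) = dB%:R * (2 * K) * `|t| by ring.
  move=> h; rewrite sqn_normc ler_sqr ?nnegrE ?normc_ge0//.
  exact: le_trans (normc_ge0 _) h.
- have di0 : 0 < d^-1 by rewrite invr_gt0.
  have Md0 : 0 <= M * d^-1 by rewrite mulr_ge0// ltW.
  rewrite /regularized; case: eqVneq => _; first by lra.
  have : (p k)^-1 <= M.
    by apply: le_trans (ler_norm _) _; rewrite /M (bigD1 k)//= lerDl sumr_ge0.
  by rewrite -/(p k); lra.
Qed.

(** Amplitudes that vanish at time 0 have squared modulus at most K^2 t^2 at time t, so the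
    divergent -ln d is multiplied by t^2. *)
Lemma ree_curve_le : exists2 K1, 0 <= K1 &
  forall t d, 0 < d <= 1 ->
  F t * ln b <= cross_entropy (alpha t) (alpha 0)
    + K1 * d - ln d * (K1 * `|t| ^+ 2).
Proof.
pose N : R := (dA * dB)%:R; have N0 : 0 <= N by rewrite ler0n.
exists (N * (1 + K ^+ 2)); first by rewrite mulr_ge0// addr_ge0// sqr_ge0.
move=> t d /[dup] d01 /andP[d0 d1].
have [q0 q1 hq] := cross_entropy_ge (alpha1 t) (alpha1 0) d01.
have s0 k : 0 < regularized (alpha 0) d k by exact: regularized_gt0.
have /andP[_] := fine_ree b1 Au Bu (alpha1 t) s0 q0 q1.
rewrite -/(F t) ler_pdivlMr// => /le_trans; apply.
apply: le_trans hq _; rewrite -/N.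
have lnd : ln d <= 0 by rewrite -ln1 ler_ln ?posrE.
have NK : 0 <= N * K ^+ 2 * d by rewrite mulr_ge0 ?(ltW d0)// mulr_ge0 ?sqr_ge0.
have : \sum_(j | sqn (alpha 0 j 0) == 0) sqn (alpha t j 0) <=
    N * (1 + K ^+ 2) * `|t| ^+ 2.
  apply: (@le_trans _ _ (\sum_(j < dA * dB) (K ^+ 2 * `|t| ^+ 2))).
    rewrite big_mkcond/=; apply: ler_sum => j _.
    case: ifP => [/eqP w0|_]; last by rewrite mulr_ge0// sqr_ge0.
    have a0 : alpha 0 j 0 = 0.
      by apply: Normc.eq0_normc; apply/eqP; rewrite -sqrf_eq0 -sqn_normc w0.
    have := alphaK t j; rewrite a0 subr0 => h.
    rewrite sqn_normc -exprMn ler_sqr ?nnegrE ?normc_ge0//.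
    exact: le_trans (normc_ge0 _) h.
  rewrite sumr_const card_ord -mulr_natl -/N.
  by have : 0 <= N * `|t| ^+ 2 by [rewrite mulr_ge0 ?sqr_ge0]; lra.
by move=> /(ler_wnM2l lnd); lra.
Qed.

Lemma ree_curve_close : exists K', forall t, `|t| <= 1 ->
  `|F t * ln b - cross_entropy (alpha t) (alpha 0)| <= K' * (`|t| * Num.sqrt `|t|).
Proof.
have [K1 K10 lo] := ree_curve_ge; have [K2 K20 up] := ree_curve_le.
exists (2 * K1 + 5 * K2) => t t1.
(* At t = 0 the regularization cannot be tied to |t|: the upper bound lets d run through 2^-n, while
   the lower error is already 0 at d = 1. *)
have [->|t0] := eqVneq t 0.
  rewrite normr0 mul0r mulr0 normr_le0 subr_eq0 eq_le; apply/andP; split.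
    apply: (@le_of_dyadic _ _ _ K2) => n.
    have := up 0 (dyadic n); rewrite dyadic_gt0 dyadic_le1 normr0 expr0n/= !mulr0.
    by move=> /(_ isT); rewrite subr0 mulrC [K2 * _]mulrC.
  have := lo 0 1; rewrite ltr01 lexx normr0 expr0n/= mulr0 mul0r subr0.
  exact.
set s := Num.sqrt `|t|.
have s0 : 0 < s by rewrite sqrtr_gt0 normr_gt0.
have s1 : s <= 1 by rewrite -sqrtr1 ler_sqrt.
have tE : `|t| = s ^+ 2 by rewrite sqr_sqrtr.
have s4 : s ^+ 4 <= s ^+ 3 by rewrite exprS ler_piMl// exprn_ge0// ltW.
have s30 : 0 < s ^+ 3 by rewrite exprn_gt0.
rewrite tE; have -> : s ^+ 2 * s = s ^+ 3 by rewrite -exprSr.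
(* The lower bound takes d = s, so t^2/d = s^3; the upper takes d = s^4 = t^2, leaving s^4 and -s^4
   ln(s^4). *)
have s01 : 0 < s <= 1 by rewrite s0.
have s401 : 0 < s ^+ 4 <= 1 by rewrite exprn_gt0//= exprn_ile1// ltW.
have := up t _ s401; have := lo t _ s01; rewrite tE -exprM => hlo hup.
have e1 : K1 * s ^+ (2 * 2) * (1 + s^-1) = K1 * s ^+ 4 + K1 * s ^+ 3.
  by field; exact: lt0r_neq0.
(* The bound -ln s <= 1/s costs one power of s. *)
have lns : - ln (s ^+ 4) * (K2 * s ^+ (2 * 2)) <= 4 * K2 * s ^+ 3.
  have hl : - ln s <= s^-1.
    rewrite -lnV ?posrE//.
    have := expR_ge1Dx (ln s^-1); rewrite lnK ?posrE ?invr_gt0//; lra.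
  have -> : 4 * K2 * s ^+ 3 = (s^-1 *+ 4) * (K2 * s ^+ (2 * 2)).
    by field; exact: lt0r_neq0.
  rewrite lnXn// -mulNrn; apply: ler_wpM2r; last by rewrite lerMn2r hl orbT.
  by rewrite mulr_ge0// exprn_ge0// ltW.
have k1 : K1 * s ^+ 4 <= K1 * s ^+ 3 by rewrite ler_wpM2l.
have k2 : K2 * s ^+ 4 <= K2 * s ^+ 3 by rewrite ler_wpM2l.
have k10 : 0 <= K1 * s ^+ 3 by rewrite mulr_ge0// ltW.
have k20 : 0 <= K2 * s ^+ 3 by rewrite mulr_ge0// ltW.
rewrite e1 in hlo.
by rewrite ler_norml; apply/andP; split; lra.
Qed.

(** The logarithms in the cross entropy are frozen at time 0, so only the squared amplitudes are
    differentiated; the remaining error has derivative 0. *)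
Lemma is_derive_ree_curve (x : 'I_(dA * dB) -> 'I_(dA * dB) -> C) d :
  (forall t j, alpha t j 0 = phase_sum (x j) d t) ->
  is_derive (0 : R) 1 F (- (\sum_j 2 *
    (complex.Re (alpha 0 j 0) * complex.Im (\sum_m x j m * (d m)%:C) -
     complex.Im (alpha 0 j 0) * complex.Re (\sum_m x j m * (d m)%:C)) *
    ln (sqn (alpha 0 j 0))) / ln b).
Proof.
move=> alphaE; have [K' close] := ree_curve_close.
pose c t := cross_entropy (alpha t) (alpha 0).
have dc : is_derive (0 : R) 1 c (- (\sum_j 2 *
    (complex.Re (alpha 0 j 0) * complex.Im (\sum_m x j m * (d m)%:C) -
     complex.Im (alpha 0 j 0) * complex.Re (\sum_m x j m * (d m)%:C)) *
    ln (sqn (alpha 0 j 0)))).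
  have -> : c = - (\sum_j (ln (sqn (alpha 0 j 0)) \*: (fun t => sqn (alpha t j 0)))).
    apply/funext => t; rewrite /c /cross_entropy [in RHS]/GRing.opp/= fct_sumE.
    by congr (- _); apply: eq_bigr => j _; rewrite /GRing.scale/= mulrC.
  apply: is_deriveN; apply: is_derive_sum => j; rewrite mulrC.
  apply: is_deriveZ.
  have -> : (fun t => sqn (alpha t j 0)) = (fun t => sqn (phase_sum (x j) d t)).
    by apply/funext => t; rewrite alphaE.
  by rewrite alphaE phase_sum0; exact: is_derive_sqn_phase_sum.
have de : is_derive (0 : R) 1 (fun t => F t * ln b - c t) 0.
  exact: (is_derive_small close).
have -> : F = (ln b)^-1 \*: ((fun t => F t * ln b - c t) + c).
  apply/funext => t; rewrite /= /GRing.scale/= addrfctE subrK mulrC mulfK//.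
  by rewrite gt_eqF.
have := is_deriveZ ((ln b)^-1) (is_deriveD de dc).
by rewrite add0r /GRing.scale/= mulrC.
Qed.

End Curve.
End Perturbation.

(** * Amplitudes in the Schmidt basis *)

Section Schmidt.
Context {R : realType}.
Local Notation C := R[i].

Definition basis_mx n (e : 'I_n -> 'cV[C]_n) : 'M[C]_n := \matrix_(i, k) e k i 0.

Lemma basis_mx_delta n (e : 'I_n -> 'cV[C]_n) k :
  basis_mx e *m delta_mx k (0 : 'I_1) = e k.
Proof. by rewrite -colE; apply/colP => i; rewrite !mxE. Qed.

Lemma basis_mx_unitary n (e : 'I_n -> 'cV[C]_n) :
  orthonormal_basis e -> basis_mx e \is unitarymx.
Proof.
move=> he; apply: adj_unitary; apply/matrixP => k l.
have /matrixP/(_ 0 0) := he k l; rewrite [RHS]mxE mulr1n !mxE => <-.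
by apply: eq_bigr => i _; rewrite !mxE.
Qed.

Lemma adj_basis_mx n (e : 'I_n -> 'cV[C]_n) k : orthonormal_basis e ->
  (basis_mx e)^t* *m e k = delta_mx k 0.
Proof.
move=> he; rewrite -{1}(basis_mx_delta e k) mulmxA unitary_adjK ?mul1mx//.
exact: basis_mx_unitary.
Qed.

(** The diagonal of a rectangular array has [minn dA dB] entries; [T] inserts their index as a
    Kronecker delta so that the sums can be exchanged. *)
Lemma sum_diag (V : nmodType) (dA dB : nat) (G : 'I_dA -> 'I_dB -> V) :
  (forall (k : 'I_dA) (l : 'I_dB), (k : nat) <> l -> G k l = 0) ->
  \sum_k \sum_l G k l = \sum_(i < minn dA dB)
    G (widen_ord (geq_minl dA dB) i) (widen_ord (geq_minr dA dB) i).
Proof.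
set iA := widen_ord (geq_minl dA dB); set iB := widen_ord (geq_minr dA dB) => G0.
pose T (i : 'I_(minn dA dB)) k l := if (k == iA i) && (l == iB i) then G k l else 0.
transitivity (\sum_k \sum_l \sum_i T i k l).
  apply: eq_bigr => k _; apply: eq_bigr => l _.
  have [kl|/G0 kl] := pselect ((k : nat) = l); last first.
    by rewrite big1 ?kl// => i _; rewrite /T; case: ifP.
  have kmin : (k < minn dA dB)%N by rewrite leq_min ltn_ord kl ltn_ord.
  rewrite (bigD1 (Ordinal kmin))//= big1 ?addr0 => [|i ik].
    by rewrite /T -!val_eqE /= kl !eqxx.
  rewrite /T; case: ifP => // /andP[/eqP ki _].
  by move: ik; rewrite -val_eqE /= ki eqxx.
under eq_bigr do rewrite exchange_big.
rewrite exchange_big; apply: eq_bigr => i _ /=.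
rewrite (bigD1 (iA i))//= [X in _ + X]big1 ?addr0 => [|k ki]; last first.
  by rewrite big1// => l _; rewrite /T (negPf ki).
rewrite (bigD1 (iB i))//= [X in _ + X]big1 ?addr0 => [|l li]; last first.
  by rewrite /T (negPf li) andbF.
by rewrite /T !eqxx.
Qed.

(** * Unitary evolution and matrix elements in the product basis *)

Lemma expi_udiag n (Q : 'M[C]_n) d (t : R) : Q \is unitarymx ->
  expi (udiag Q d) t = Q^t* *m diag_mx (\row_k (cos (t * d k) +i* sin (t * d k))) *m Q.
Proof. by move=> Qu; rewrite /expi herm_funE. Qed.

Lemma adj_expi n (H : 'M[C]_n) (t : R) : H^t* = H ->
  (expi H (- t))^t* = expi H t.
Proof.
move=> /hermitian_udiag[Q Qu [d ->]]; rewrite !expi_udiag//.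
have : (diag_mx (\row_k (cos (- t * d k) +i* sin (- t * d k))))^t* =
    diag_mx (\row_k (cos (t * d k) +i* sin (t * d k))) :> 'M[C]_n.
  apply/matrixP => i j; rewrite !mxE eq_sym.
  case: eqVneq => [->|_]; rewrite ?mulr1n ?mulr0n ?rmorph0//.
  by rewrite conjCE /= mulNr cosN sinN opprK.
move: (diag_mx _) (diag_mx _) => D E DE.
by rewrite adjM adjM adjK DE mulmxA.
Qed.

Lemma expi_unitary n (H : 'M[C]_n) (t : R) : H^t* = H -> expi H t \is unitarymx.
Proof.
move=> /[dup] Hh /hermitian_udiag[Q Qu [d dE]]; apply: adj_unitary.
rewrite -{1}[t]opprK (adj_expi _ Hh) dE !(expi_udiag _ _ Qu) (conj_unitaryM _ _ Qu).
have -> : diag_mx (\row_k (cos (- t * d k) +i* sin (- t * d k))) *m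
    diag_mx (\row_k (cos (t * d k) +i* sin (t * d k))) = 1%:M :> 'M[C]_n.
  rewrite mulmx_diag; apply/matrixP => i j; rewrite !mxE; congr (_ *+ _).
  rewrite mulNr cosN sinN; apply/eqP; rewrite eq_complex /=; apply/andP; split; apply/eqP.
    by rewrite -[RHS](cos2Dsin2 (t * d i)); ring.
  by ring.
by rewrite mulmx1 unitary_adjK.
Qed.

Section Amplitudes.
Variables (dA dB : nat) (eA : 'I_dA -> 'cV[C]_dA) (eB : 'I_dB -> 'cV[C]_dB).
Hypotheses (heA : orthonormal_basis eA) (heB : orthonormal_basis eB).
Variable c : 'I_(minn dA dB) -> R.
Let iA := widen_ord (geq_minl dA dB).
Let iB := widen_ord (geq_minr dA dB).
Let U := basis_mx eA *t basis_mx eB.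
Variable psi : 'cV[C]_(dA * dB).
Hypothesis psiE : psi = \sum_i (c i)%:C *: (eA (iA i) *t eB (iB i)).

Lemma amplitudeE k l : (U^t* *m psi) (mxtens_index (k, l)) 0 =
  \sum_i (c i)%:C * ((k == iA i) && (l == iB i))%:R.
Proof.
rewrite psiE mulmx_sumr summxE; apply: eq_bigr => i _.
rewrite -scalemxAr mxE /U adj_tens.
have -> : ((basis_mx eA)^t* *t (basis_mx eB)^t*) *m
    (eA (iA i) *t eB (iB i) : 'cV[C]_(dA * dB)) =
    ((basis_mx eA)^t* *m eA (iA i)) *t ((basis_mx eB)^t* *m eB (iB i)).
  exact: (@tensmx_mul _ dA dA dB dB 1 1).
rewrite !adj_basis_mx// mxE mxtens_indexK /= !mxE.
have o1 (x : 'I_1) : (x == 0) = true by rewrite ord1.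
by rewrite !o1 !andbT -natrM mulnb.
Qed.

Lemma amplitude_offdiag (k : 'I_dA) (l : 'I_dB) : (k : nat) <> l ->
  (U^t* *m psi) (mxtens_index (k, l)) 0 = 0.
Proof.
move=> kl; rewrite amplitudeE big1// => i _.
case: eqP => [ki|_]; last by rewrite mulr0.
by case: eqP => [li|_]; [case: kl; rewrite ki li|rewrite mulr0].
Qed.

Lemma amplitude_diag i : (U^t* *m psi) (mxtens_index (iA i, iB i)) 0 = (c i)%:C.
Proof.
rewrite amplitudeE (bigD1 i)//= !eqxx mulr1 big1 ?addr0// => j ji.
by rewrite -val_eqE/= eq_sym val_eqE (negPf ji) mulr0.
Qed.

(** Row k can be nonzero only in column k, hence distinct rows share no column. *)
Lemma amplitude_schmidt_form : schmidt_form (U^t* *m psi).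
Proof.
split=> [k m km|k l].
  rewrite /reduced mxE big1// => l _; rewrite adjE ![coef_mx _ _ _]mxE.
  have [kl|/amplitude_offdiag->] := pselect ((k : nat) = l); last by rewrite mul0r.
  rewrite (@amplitude_offdiag m l) ?conjc0 ?mulr0// => ml.
  by case/eqP: km; apply: val_inj; rewrite /= kl.
have z0 : sqn (0 : C) = 0 by rewrite /sqn/= expr0n addr0.
have [kl|/amplitude_offdiag->] := pselect ((k : nat) = l); last by left.
right; rewrite reduced_diagE (bigD1 l)//= big1 ?addr0// => l' l'l.
rewrite amplitude_offdiag// => kl'.
by case/eqP: l'l; apply: val_inj; rewrite /= -kl'.
Qed.

Variable h : 'I_dA -> 'I_dA -> 'I_dB -> 'I_dB -> C.
Variable H : 'M[C]_(dA * dB).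
Hypothesis HE : H = \sum_(k < dA) \sum_(l < dA) \sum_(m < dB) \sum_(n < dB)
  h k l m n *: ((eA k *m (eA l)^t*) *t (eB m *m (eB n)^t*)).

(** Indices regroup: the coefficient pairs k with l and m with n, while the matrix has row (k, m)
    and column (l, n). *)
Lemma matrix_elementE k m l n :
  (U^t* *m H *m U) (mxtens_index (k, m)) (mxtens_index (l, n)) = h k l m n.
Proof.
have term k' l' m' n' :
    U^t* *m ((eA k' *m (eA l')^t*) *t (eB m' *m (eB n')^t*)) *m U =
    delta_mx k' l' *t delta_mx m' n'.
  have ad N (e : 'I_N -> 'cV[C]_N) i : orthonormal_basis e ->
      (e i)^t* *m basis_mx e = delta_mx 0 i.
    move=> he; rewrite -[LHS]adjK adjM adjK adj_basis_mx//.
    by rewrite trmx_delta map_delta_mx.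
  rewrite /U adj_tens !tensmx_mul !mulmxA !adj_basis_mx//.
  by rewrite -!mulmxA !ad// !mul_delta_mx.
have -> : U^t* *m H *m U = \sum_(k < dA) \sum_(l < dA) \sum_(m < dB) \sum_(n < dB)
    h k l m n *: (delta_mx k l *t delta_mx m n).
  rewrite HE; do 4 (rewrite mulmx_sumr mulmx_suml; apply: eq_bigr => ? _).
  by rewrite -scalemxAr -scalemxAl term.
transitivity (\sum_k' \sum_l' \sum_m' \sum_n' h k' l' m' n' *
    (((k == k') && (l == l'))%:R * ((m == m') && (n == n'))%:R)).
  do 4 (rewrite summxE; apply: eq_bigr => ? _).
  by rewrite mxE tensmxE !mxE.
rewrite (bigD1 k)//= [X in _ + X]big1 ?addr0 => [|k' kk']; last first.
  do 3 (apply: big1 => ? _).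
  by rewrite [k == _]eq_sym (negPf kk') mul0r mulr0.
rewrite (bigD1 l)//= [X in _ + X]big1 ?addr0 => [|l' ll']; last first.
  do 2 (apply: big1 => ? _).
  by rewrite [l == _]eq_sym (negPf ll') andbF mul0r mulr0.
rewrite (bigD1 m)//= [X in _ + X]big1 ?addr0 => [|m' mm']; last first.
  apply: big1 => ? _.
  by rewrite [m == _]eq_sym (negPf mm') !mulr0.
rewrite (bigD1 n)//= [X in _ + X]big1 ?addr0 => [|n' nn']; last first.
  by rewrite [n == _]eq_sym (negPf nn') andbF !mulr0.
by rewrite !eqxx !mulr1.
Qed.

End Amplitudes.

Lemma sum_lt_pairs n (f : 'I_n -> 'I_n -> R) : (forall i, f i i = 0) ->
  \sum_i \sum_j f i j = \sum_(i < n) \sum_(j < n | (j < i)%N) (f i j + f j i).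
Proof.
move=> f0; under [RHS]eq_bigr do rewrite big_split.
rewrite big_split/=.
rewrite [X in _ = _ + X](exchange_big_dep xpredT)//= -big_split/=.
apply: eq_bigr => i _; rewrite (bigID (fun j : 'I_n => (j < i)%N))/=.
congr (_ + _); rewrite (bigD1 i) ?ltnn//= f0 add0r.
apply: eq_bigl => j; rewrite -leqNgt [RHS]ltn_neqAle andbC.
by congr (_ && _); rewrite eq_sym.
Qed.

Lemma curve_amplitude b dA dB (U : 'M[C]_(dA * dB)) (psi : 'cV[C]_(dA * dB)) H t :
  U \is unitarymx -> H^t* = H ->
  let v := U *m (U^t* *m (expi H (- t) *m psi)) in
  entanglement_curve b psi H t =
  fine (relative_entropy_of_entanglement b (v *m v^t*)).
Proof.
move=> Uu Hh v.
have -> : v = expi H (- t) *m psi by rewrite /v mulmxA unitary_Kadj ?mul1mx.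
rewrite /entanglement_curve.
have -> // : (expi H (- t) *m psi) *m (expi H (- t) *m psi)^t* =
    expi H (- t) *m (psi *m psi^t*) *m expi H t.
rewrite adjM (adj_expi _ Hh).
by move: (expi H _) (expi H _) => A B; rewrite !mulmxA.
Qed.

Lemma curve_phase_sum dA dB (U Q : 'M[C]_(dA * dB)) (psi : 'cV[C]_(dA * dB)) d t j :
  Q \is unitarymx ->
  (U^t* *m (expi (udiag Q d) (- t) *m psi)) j 0 =
  phase_sum (fun m => (U^t* *m Q^t*) j m * (Q *m psi) m 0) d t.
Proof.
move=> Qu; rewrite (expi_udiag _ _ Qu) !mulmxA -(mulmxA _ Q).
move: (U^t* *m Q^t*) (Q *m psi) => A B.
rewrite mul_mx_diag mxE; apply: eq_bigr => m _.
by rewrite [X in X * _ = _]mxE [X in _ * X * _]mxE mulrAC.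
Qed.

(** Turns the frequency-weighted sum in the derivative back into an amplitude of H psi. *)
Lemma udiag_phase_sum dA dB (U Q : 'M[C]_(dA * dB)) (psi : 'cV[C]_(dA * dB)) d j :
  \sum_m (U^t* *m Q^t*) j m * (Q *m psi) m 0 * (d m)%:C =
  (U^t* *m udiag Q d *m psi) j 0.
Proof.
have -> : U^t* *m udiag Q d *m psi =
    U^t* *m Q^t* *m diag_mx (\row_k (d k)%:C) *m (Q *m psi).
  by rewrite /udiag !mulmxA.
move: (U^t* *m Q^t*) (Q *m psi) => A B.
rewrite mul_mx_diag mxE; apply: eq_bigr => m _.
by rewrite [X in _ = X * _]mxE [X in _ = _ * X * _]mxE mulrAC.
Qed.

End Schmidt.

(** Derivability is asserted with the formula because [derive1] has a value even where no derivative
    exists. *)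
Theorem proposition1 (R : realType) (b : R) (hb : 1 < b) (dA dB : nat)
  (eA : 'I_dA -> 'cV[R[i]]_dA) (eB : 'I_dB -> 'cV[R[i]]_dB)
  (heA : orthonormal_basis eA) (heB : orthonormal_basis eB)
  (C : 'I_(minn dA dB) -> R) (hC : forall i, 0 <= C i)
  (psi : 'cV[R[i]]_(dA * dB))
  (hpsi : psi = \sum_(i < minn dA dB)
     (C i)%:C *: (eA (widen_ord (geq_minl dA dB) i)
                  *t eB (widen_ord (geq_minr dA dB) i)))
  (hunit : psi^t* *m psi = 1%:M)
  (h : 'I_dA -> 'I_dA -> 'I_dB -> 'I_dB -> R[i])
  (H : 'M[R[i]]_(dA * dB))
  (hH : H = \sum_(k < dA) \sum_(l < dA) \sum_(m < dB) \sum_(n < dB)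
     h k l m n *: ((eA k *m (eA l)^t*) *t (eB m *m (eB n)^t*)))
  (hherm : H \is hermsymmx) :
  derivable (entanglement_curve b psi H) 0 1 /\
  entanglement_rate b psi H =
    4 * \sum_(i < minn dA dB) \sum_(j < minn dA dB | (j < i)%N)
      C i * C j * logb b (C i / C j) *
      complex.Im (h (widen_ord (geq_minl dA dB) j) (widen_ord (geq_minl dA dB) i)
            (widen_ord (geq_minr dA dB) j) (widen_ord (geq_minr dA dB) i)).
Proof.
have Hh := hermsym_adj hherm; have [Q Qu [d dE]] := hermitian_udiag Hh.
have Au := basis_mx_unitary heA; have Bu := basis_mx_unitary heB.
pose U := basis_mx eA *t basis_mx eB.
have Uu : U \is unitarymx by exact: tens_unitary.
(* Amplitudes of the evolved state in the Schmidt product basis of time 0, which stays fixed. *)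
pose alpha t := U^t* *m (expi H (- t) *m psi).
pose x j m := (U^t* *m Q^t*) j m * (Q *m psi) m 0.
have alphaE t j : alpha t j 0 = phase_sum (x j) d t.
  by rewrite /alpha dE; exact: (curve_phase_sum _ _ _ _ _ Qu).
have alpha0 : alpha 0 = U^t* *m psi.
  apply/colP => j; rewrite alphaE phase_sum0.
  rewrite -[psi]mul1mx -(unitary_adjK Qu) -(mulmxA _ Q) [U^t* *m _]mulmxA.
  by rewrite [RHS]mxE.
have alpha1 t : (alpha t)^t* *m alpha t = 1%:M.
  rewrite /alpha unitary_normE ?trmxC_unitary//.
  by rewrite (unitary_normE psi (expi_unitary (- t) Hh)).
have curveE t : entanglement_curve b psi H t = fine (relative_entropy_of_entanglement b
    ((U *m alpha t) *m (U *m alpha t)^t*)).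
  exact: (curve_amplitude b psi t Uu Hh).
have betaE j : \sum_m x j m * (d m)%:C =
    ((U^t* *m H *m U) *m (U^t* *m psi)) j 0.
  rewrite udiag_phase_sum -dE -[in LHS](mul1mx psi) -(unitary_Kadj Uu).
  by move: (U^t*) => V; rewrite !mulmxA.
clearbody alpha x.
(* Summing the Lipschitz constants over [j] gives one valid for every amplitude. *)
pose K := \sum_j \sum_m Normc.normc (x j m) * (2 * `|d m|).
have alphaK t j : Normc.normc (alpha t j 0 - alpha 0 j 0) <= K * `|t|.
  rewrite !alphaE; apply: le_trans (phase_sum_lipschitz _ _ _) _.
  apply: ler_wpM2r => //; rewrite /K [leRHS](bigD1 j)//= lerDl sumr_ge0// => i _.
  by rewrite sumr_ge0// => m _; rewrite !mulr_ge0 ?normc_ge0.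
have schmidt0 : schmidt_form (alpha 0).
  by rewrite alpha0; exact: (amplitude_schmidt_form heA heB hpsi).
have := is_derive_ree_curve hb Au Bu alpha1 alphaK schmidt0 alphaE.
have -> : (fun t => fine (relative_entropy_of_entanglement b
    (((basis_mx eA *t basis_mx eB) *m alpha t) *m
     ((basis_mx eA *t basis_mx eB) *m alpha t)^t*))) = entanglement_curve b psi H.
  by apply/funext => t; rewrite curveE.
set D := (X in is_derive _ _ _ X) => dF.
have [dF1 dF2] := dF; split; first exact: dF1.
rewrite /entanglement_rate derive1E dF2 {dF dF1 dF2} /D {D}.
set iA := widen_ord (geq_minl dA dB); set iB := widen_ord (geq_minr dA dB).
pose g i j := complex.Im (h (iA i) (iA j) (iB i) (iB j)).
(* Hermiticity of H: transposed entries are conjugate, so their imaginary parts are opposite. *)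
have gN i j : g i j = - g j i.
  rewrite /g -!(matrix_elementE heA heB hH) -/U.
  have : (U^t* *m H *m U)^t* = U^t* *m H *m U by rewrite !adjM adjK Hh mulmxA.
  move: (U^t* *m H *m U) => G GE; rewrite -[in LHS]GE adjE.
  by case: (G _ _).
have -> : \sum_j 2 * (complex.Re (alpha 0 j 0) * complex.Im (\sum_m x j m * (d m)%:C)
     - complex.Im (alpha 0 j 0) * complex.Re (\sum_m x j m * (d m)%:C))
     * ln (sqn (alpha 0 j 0)) =
    4 * \sum_i \sum_j C i * C j * ln (C i) * g i j.
  rewrite alpha0 sum_mxtens sum_diag => [|k l kl]; last first.
    by rewrite (amplitude_offdiag heA heB hpsi kl) /= !mul0r subr0 mulr0 mul0r.
  rewrite mulr_sumr; apply: eq_bigr => i _.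
  rewrite (amplitude_diag heA heB hpsi) /= mul0r subr0 betaE.
  have -> : ((U^t* *m H *m U) *m (U^t* *m psi)) (mxtens_index (iA i, iB i)) 0 =
      \sum_j h (iA i) (iA j) (iB i) (iB j) * (C j)%:C.
    rewrite mxE sum_mxtens sum_diag => [|k l kl]; last first.
      by rewrite (amplitude_offdiag heA heB hpsi kl) mulr0.
    apply: eq_bigr => j _.
    by rewrite (matrix_elementE heA heB hH) (amplitude_diag heA heB hpsi).
  (* This doubling and the 2 from the derivative make the factor 4; at [C i = 0] both logarithms are
     0 by convention. *)
  have -> : ln (sqn (C i)%:C) = ln (C i) *+ 2.
    rewrite /sqn /= expr0n addr0; have := hC i; rewrite le_eqVlt => /orP[/eqP<-|Ci].
      by rewrite expr0n/= ln0// mul0rn.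
    by rewrite lnXn.
  rewrite Im_sum !mulr_sumr mulr_suml; apply: eq_bigr => j _.
  by rewrite [h _ _ _ _ * _]mulrC ImM_real -/(g i j); ring.
rewrite sum_lt_pairs => [|i]; last first.
  by have : g i i = 0 by [have := gN i i; lra]; move=> ->; rewrite mulr0.
(* Antisymmetry of [g] merges each pair into ln C_i - ln C_j, and exchanging the indices of [g]
   absorbs the overall minus sign. *)
rewrite -mulrN -mulrA -sumrN mulr_suml; congr (4 * _); apply: eq_bigr => i _.
rewrite -sumrN mulr_suml; apply: eq_bigr => j _.
rewrite -/(g j i) (gN i j) /logb.
(* A zero coefficient makes both sides 0; otherwise the logarithm of the quotient splits. *)
have [Ci|Ci] := eqVneq (C i) 0; first by rewrite Ci !(mul0r, mulr0, oppr0, addr0).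
have [Cj|Cj] := eqVneq (C j) 0; first by rewrite Cj !(mul0r, mulr0, oppr0, addr0).
rewrite ln_div ?posrE ?lt0r ?Ci ?Cj ?hC//.
by ring.
Qed.
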